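(* Let $K$ be a strictly concave kernel function which either satisfies condition $(\infty')$ or belongs to $\mathrm{C}^1(0,2\pi)$. Let $r_0,r_1,\dots,r_n>0$, $K_j:=r_jK$, and \[F(\mathbf{y},t)=K_0(t)+\sum_{j=1}^nK_j(t-y_j)=r_0K(t)+\sum_{j=1}^nr_jK(t-y_j).\] Let $S=S_\sigma$ be a simplex. Then there is a unique $\mathbf{w}^*=(w_1,\dots,w_n)\in S$ with \[M(S):=\inf_{\mathbf{y}\in S}\sup_{t\in\mathbb{T}}F(\mathbf{y},t)=\sup_{t\in\mathbb{T}}F(\mathbf{w}^*,t).\] Moreover: (a) the nodes $w_0=0,w_1,\dots,w_n$ are different and $\mathbf{w}^*$ is an equioscillation point, $m_0(\mathbf{w}^* )=\dots=m_n(\mathbf{w}^* )$; (b) $\inf_{\mathbf{y}\in S}\max_{j}\sup_{t\in I_j(\mathbf{y})}F(\mathbf{y},t)=M(S)=m(S)=\sup_{\mathbf{y}\in S}\min_j\sup_{t\in I_j(\mathbf{y})}F(\mathbf{y},t)$; (c) the Sandwich Property holds in $\overline{S}$: for all $\mathbf{x},\mathbf{y}\in\overline{S}$, $\underline{m}(\mathbf{x})\le M(S)\le\overline{m}(\mathbf{y})$.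
   Context: Identify the torus $\mathbb{T}=\mathbb{R}/2\pi\mathbb{Z}$ with $[0,2\pi)$. A concave kernel function is a $2\pi$-periodic function $K:\mathbb{R}\to[-\infty,\infty)$ which is real-valued and concave on $(0,2\pi)$ and such that $\lim_{t\downarrow0}K(t)$ and $\lim_{t\uparrow2\pi}K(t)$ exist in $[-\infty,\infty)$ and are equal; it is strictly concave if strictly concave on $(0,2\pi)$. Condition $(\infty')$: either $\lim_{t\uparrow2\pi}D_\pm K(t)=-\infty$ (both one-sided derivatives), or $\lim_{t\downarrow0}D_\pm K(t)=+\infty$. For $\mathbf{y}\in\mathbb{T}^n$ put $y_0=0$, $y_{n+1}=2\pi$. For a permutation $\sigma$ of $\{1,\dots,n\}$ with $\sigma(0)=0,\sigma(n+1)=n+1$, $S_\sigma=\{\mathbf{y}:0<y_{\sigma(1)}<\dots<y_{\sigma(n)}<2\pi\}$ and $\overline{S_\sigma}$ is the set where $0\le y_{\sigma(1)}\le\dots\le y_{\sigma(n)}\le2\pi$. For $\mathbf{y}\in\overline{S_\sigma}$: $I_{\sigma(k)}(\mathbf{y})=[y_{\sigma(k)},y_{\sigma(k+1)}]$, $m_{\sigma(k)}(\mathbf{y})=\sup_{t\in I_{\sigma(k)}(\mathbf{y})}F(\mathbf{y},t)$ ($k=0,\dots,n$), $\overline{m}=\max_jm_j$, $\underline{m}=\min_jm_j$, $m(S)=\sup_{\mathbf{y}\in S}\underline{m}(\mathbf{y})$. An equioscillation point is a $\mathbf{y}$ with all $m_j(\mathbf{y})$ equal.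
   Formalization: The kernel K is also required to take at 0 the common value of its one-sided limits, K(0)=lim_{t↓0}K(t)=lim_{t↑2π}K(t); without this the claim fails, e.g. n=1, K(t)=t(2π−t) on (0,2π), K(0)=100, where the infimum is not attained in S. *)

(* Defs.v *)
From HB Require Import structures.
From mathcomp Require Import all_boot all_order all_algebra.
From mathcomp Require Import all_classical all_reals all_analysis.
From mathcomp Require Import fingroup perm.
Set Implicit Arguments. Unset Strict Implicit. Unset Printing Implicit Defensive.
Import Order.TTheory GRing.Theory Num.Theory.
Import numFieldNormedType.Exports.
Local Open Scope classical_set_scope.
Local Open Scope ring_scope.

Section Kernel.
Variable R : realType.
Implicit Types (K : R -> \bar R).

(* real part of K (meaningful on (0,2pi), where K is real-valued) *)
Definition kfin K : R -> R := fun t => fine (K t).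

Definition concave_kernel K : Prop :=
  (forall t, K (t + 2 * pi) = K t) /\
  (forall t, 0 < t < 2 * pi -> K t \is a fin_num) /\
  (forall x y l, 0 < x < 2 * pi -> 0 < y < 2 * pi -> 0 <= l <= 1 ->
     l * kfin K x + (1 - l) * kfin K y <= kfin K (l * x + (1 - l) * y)) /\
  (exists L : \bar R, L != +oo%E /\
     (K t @[t --> 0^'+] --> L) /\ (K t @[t --> (2 * pi)^'-] --> L) /\
     K 0 = L).

Definition strictly_concave_kernel K : Prop :=
  concave_kernel K /\
  (forall x y l, 0 < x < 2 * pi -> 0 < y < 2 * pi -> x != y -> 0 < l < 1 ->
     l * kfin K x + (1 - l) * kfin K y < kfin K (l * x + (1 - l) * y)).

Definition is_rderiv (f : R -> R) (t l : R) : Prop :=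
  (fun h => (f (t + h) - f t) / h) @ 0^'+ --> l.
Definition is_lderiv (f : R -> R) (t l : R) : Prop :=
  (fun h => (f (t + h) - f t) / h) @ 0^'- --> l.

Definition cond_inf' K : Prop :=
  (forall M : R, \forall t \near (2 * pi)^'-, forall l,
      (is_rderiv (kfin K) t l \/ is_lderiv (kfin K) t l) -> l <= M) \/
  (forall M : R, \forall t \near 0^'+, forall l,
      (is_rderiv (kfin K) t l \/ is_lderiv (kfin K) t l) -> M <= l).

Definition C1_0_2pi K : Prop :=
  forall t, 0 < t < 2 * pi ->
    derivable (kfin K) t 1 /\ {for t, continuous (derive1 (kfin K))}.

Definition Fsum n K (r0 : R) (r : 'I_n -> R) (y : 'I_n -> R) (t : R) : \bar R :=
  ((r0%:E * K t) + \sum_(j < n) ((r j)%:E * K (t - y j)%R))%E.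

(* sorted nodes: node 0 = 0, node k = y_{sigma(k)} (1<=k<=n), node (n+1) = 2pi *)
Definition node n (s : 'S_n) (y : 'I_n -> R) (k : nat) : R :=
  if k is k'.+1 then
    (match (insub k' : option 'I_n) with Some i => y (s i) | None => 2 * pi end)
  else 0.

Definition Ssig n (s : 'S_n) : set ('I_n -> R) :=
  [set y | forall k : nat, (k <= n)%N -> node s y k < node s y k.+1].
Definition Ssig_cl n (s : 'S_n) : set ('I_n -> R) :=
  [set y | forall k : nat, (k <= n)%N -> node s y k <= node s y k.+1].

Definition supF n K r0 r (y : 'I_n -> R) : \bar R :=
  ereal_sup [set Fsum K r0 r y t | t in [set t | 0 <= t < 2 * pi]].

(* m_{sigma(k)}(y) = sup of F(y,.) over I_{sigma(k)}(y) = [node k, node (k+1)] *)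
Definition mint n K r0 r (s : 'S_n) (y : 'I_n -> R) (k : 'I_n.+1) : \bar R :=
  ereal_sup [set Fsum K r0 r y t |
               t in [set t | node s y k <= t <= node s y k.+1]].

Definition mbar n K r0 r (s : 'S_n) (y : 'I_n -> R) : \bar R :=
  (\big[maxe/-oo]_(k < n.+1) mint K r0 r s y k)%E.
Definition mlow n K r0 r (s : 'S_n) (y : 'I_n -> R) : \bar R :=
  (\big[mine/+oo]_(k < n.+1) mint K r0 r s y k)%E.

Definition MS n K r0 r (s : 'S_n) : \bar R :=
  ereal_inf [set supF K r0 r y | y in Ssig s].
Definition mS n K r0 r (s : 'S_n) : \bar R :=
  ereal_sup [set mlow K r0 r s y | y in Ssig s].

End Kernel.

(* Main.v *)
(* Seen on the circle, the node 0 is a node like the others, so one has n + 1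
   cyclically ordered nodes x_0 <= ... <= x_n <= x_0 + 2 pi with positive weights,
   and F(x, t) = sum_j rho_j K(t - x_j).

   - A minimizer x* of sup_t F(x, t) exists over the closed simplex, by lower
     semicontinuity and compactness.
   - Condition (oo') or C^1 forbids the maximum of F(x, .) at a node.
   - The maximum of F(x*, .) is attained on every arc: if an arc missed it, pulling
     the two ends of that arc apart, by amounts inversely proportional to their
     weights, would strictly decrease F outside the arc by concavity, and keep it
     below the maximum on the arc by continuity.  Hence x* is an equioscillation
     point and its nodes are distinct.
   - On the j-th arc F is jointly concave in (x, t), so m_j is concave on the closed
     simplex.  If all m_j(y) exceeded M = sup F(x*, .), then at a point slightly
     beyond x* on the ray from y through x* all the m_j would be < M, contradicting
     minimality.  This is the sandwich property, and with strict concavity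
     (applied to a midpoint) it also yields uniqueness. *)
Require Import Defs.
From HB Require Import structures.
From mathcomp Require Import all_boot all_order all_algebra.
From mathcomp Require Import all_classical all_reals all_analysis.
From mathcomp Require Import fingroup perm.
From mathcomp Require Import ring lra.
Import Order.TTheory GRing.Theory Num.Theory.
Import numFieldNormedType.Exports.
Set Implicit Arguments. Unset Strict Implicit. Unset Printing Implicit Defensive.
Local Open Scope classical_set_scope.
Local Open Scope ring_scope.

(** * Chord slopes of concave functions, and extrema on compact sets *)

Definition strictly_concave_on (R : realType) (D : set R) (f : R -> R) :=
  forall u m v, D u -> D v -> u < m -> m < v ->
    (v - m) * f u + (m - u) * f v < (v - u) * f m.

(** Adjacent chords compare directly by concavity; across a gap [b < c] the chord over [[b, c]] has
    an intermediate slope. *)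
Lemma slope_lt (R : realType) (D : set R) (f : R -> R) (a b c d : R) :
  strictly_concave_on D f -> D a -> D b -> D c -> D d ->
  a < b -> b <= c -> c < d -> (f d - f c) / (d - c) < (f b - f a) / (b - a).
Proof.
move=> fD Da Db Dc Dd ab bc cd.
have adj u m v : D u -> D v -> u < m -> m < v ->
    (f v - f m) / (v - m) < (f m - f u) / (m - u).
  move=> Du Dv um mv; have := fD _ _ _ Du Dv um mv.
  have mu0 : 0 < m - u by rewrite subr_gt0.
  have vm0 : 0 < v - m by rewrite subr_gt0.
  by rewrite ltr_pdivrMr// mulrAC ltr_pdivlMr// => ?; lra.
have [ebc|bc'] := eqVneq b c; first by rewrite -ebc; rewrite -ebc in cd; exact: adj.
have {bc' bc} bc : b < c by rewrite lt_neqAle bc'.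
exact: lt_trans (adj _ _ _ Db Dd bc cd) (adj _ _ _ Da Dc ab bc).
Qed.

(** Near [t], the slope of a chord issuing from [t] stays between [s2] and [s1], the slopes over
    [[t, d]] and [[c, t]]. This bounds the increments of [f] at [t] by [C] times the distance. *)
Lemma strictly_concave_continuous (R : realType) (a b : R) (f : R -> R) t :
  strictly_concave_on `]a, b[%classic f -> a < t < b -> f x @[x --> t] --> f t.
Proof.
move=> fD /andP[at_ tb].
pose c := (a + t) / 2; pose d := (t + b) / 2.
have [ac ct td db] : [/\ a < c, c < t, t < d & d < b].
  by rewrite /c /d; split; lra.
have Dt : `]a, b[%classic t by rewrite /= in_itv/= at_.
have Dc : `]a, b[%classic c by rewrite /= in_itv/= ac; lra.
have Dd : `]a, b[%classic d by rewrite /= in_itv/= db; lra.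
pose s1 := (f t - f c) / (t - c); pose s2 := (f d - f t) / (d - t).
pose C := `|s1| + `|s2| + 1.
have C0 : 0 < C by rewrite /C ltr_wpDl// addr_ge0.
have lipR x : t < x -> x < d -> `|f t - f x| <= C * `|t - x|.
  move=> tx xd.
  have Dx : `]a, b[%classic x by rewrite /= in_itv/=; apply/andP; split; lra.
  have h1 := slope_lt fD Dc Dt Dt Dx ct (lexx t) tx.
  have h2 := slope_lt fD Dt Dx Dx Dd tx (lexx x) xd.
  have xt0 : 0 < x - t by rewrite subr_gt0.
  set q := (f x - f t) / (x - t) in h1 h2.
  have -> : f t - f x = - (q * (x - t)) by rewrite /q mulfVK ?lt0r_neq0//; lra.
  rewrite normrN normrM [`|t - x|]distrC ler_wpM2r//.
  have s2q : s2 < q.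
    have := fD _ _ _ Dt Dd tx xd; rewrite /s2 /q ltr_pdivrMr ?subr_gt0//.
    rewrite mulrAC ltr_pdivlMr// => ?; lra.
  rewrite -/s1 in h1; rewrite ler_norml /C.
  have := ler_norm s1; have := ler_norm (- s2); rewrite normrN.
  have := normr_ge0 s1; have := normr_ge0 s2; move=> *; apply/andP; split; lra.
have lipL x : c < x -> x < t -> `|f t - f x| <= C * `|t - x|.
  move=> cx xt.
  have Dx : `]a, b[%classic x by rewrite /= in_itv/=; apply/andP; split; lra.
  have h1 := slope_lt fD Dx Dt Dt Dd xt (lexx t) td.
  have xt0 : 0 < t - x by rewrite subr_gt0.
  set q := (f t - f x) / (t - x) in h1.
  have -> : f t - f x = q * (t - x) by rewrite /q mulfVK ?lt0r_neq0//.
  rewrite normrM ler_wpM2r//.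
  have s2q : q < s1.
    have := fD _ _ _ Dc Dt cx xt; rewrite /s1 /q ltr_pdivrMr ?subr_gt0//.
    rewrite mulrAC ltr_pdivlMr ?subr_gt0// => ?; lra.
  rewrite -/s2 in h1; rewrite ler_norml /C.
  have := ler_norm s1; have := ler_norm (- s2); rewrite normrN.
  have := normr_ge0 s1; have := normr_ge0 s2; move=> *; apply/andP; split; lra.
apply/cvgrPdist_le => e e0; near=> x.
have xeC : `|t - x| <= e / C.
  by near: x; apply: cvgr_dist_le => //; exact: divr_gt0.
apply: (@le_trans _ _ (C * `|t - x|)); last by rewrite mulrC -ler_pdivlMr.
have cx : c < x by near: x; exact: lt_nbhsr.
have xd : x < d by near: x; exact: lt_nbhsl.
case: (ltgtP x t) => [xt|tx|->]; [exact: lipL|exact: lipR|].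
by rewrite !subrr normr0 mulr0.
Unshelve. all: by end_near. Qed.

Lemma compact_lsc_min (R : realType) (T : topologicalType) (A : set T)
    (f : T -> \bar R) :
  compact A -> A !=set0 ->
  (forall x c, A x -> (c < f x)%E -> \forall x' \near x, (c < f x')%E) ->
  exists2 x, A x & forall z, A z -> (f x <= f z)%E.
Proof.
move=> cA [a0 Aa0] lsc; apply: contrapT => /forallPNP nomin.
have {}nomin x : A x -> exists2 z, A z & (f z < f x)%E.
  move=> Ax; apply: contrapT => /forallPNP h; apply: (nomin x Ax) => z Az.
  by rewrite leNgt; apply/negP; exact: h.
(* The sublevel sets of [f] are nested, hence form a filter base. Without a minimizer, the
   near-covering form of compactness yields some [z] whose value lies below every value on [A], its
   own included. *)
pose F := filter_from A (fun z => [set z' | A z' /\ (f z' <= f z)%E]).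
have FF : Filter F.
  apply: filter_from_filter; first by exists a0.
  move=> i j Ai Aj; case: (leP (f i) (f j)) => ij.
  - by exists i => // z [Az zi]; do 2!split => //; exact: le_trans ij.
  - by exists j => // z [Az zj]; do 2!split => //; exact: le_trans (ltW ij).
have /compact_near_coveringP/(_ T F (fun z x => (f z < f x)%E) FF) := cA.
case=> [x Ax|z Az /(_ z)].
  have [z Az zx] := nomin _ Ax.
  exists ([set x' | (f z < f x')%E], [set z' | A z' /\ (f z' <= f z)%E]) => /=.
    by split; [exact: lsc|exists z].
  by move=> [x' z'] /= [zx' [_ z'z]]; exact: le_lt_trans zx'.
move=> h; have zz : [set z' | A z' /\ (f z' <= f z)%E] z by split.
by have := h zz z Az; rewrite ltxx.
Qed.

Lemma compact_cont_max (R : realType) (T : topologicalType) (A : set T)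
    (f : T -> \bar R) :
  compact A -> A !=set0 -> continuous f ->
  exists2 x, A x & forall z, A z -> (f z <= f x)%E.
Proof.
move=> cA A0 cf.
have [x c Ax cx|x Ax mx] := @compact_lsc_min R T A (fun x => - f x)%E cA A0.
  have cNf : continuous (fun x => - f x)%E.
    by move=> y; apply: cvgeN; exact: cf.
  apply: (cNf x [set y | (c < y)%E]); apply: open_nbhs_nbhs; split => //.
  exact: open_ereal_gt_ereal.
by exists x => // z Az; rewrite -leeN2; exact: mx.
Qed.

(** * The kernel on a closed period: continuity and concavity up to the endpoints *)

Section Kernel.
Variables (R : realType) (K : R -> \bar R).
Hypothesis sK : strictly_concave_kernel K.
Local Notation k := (kfin K).

Lemma twopi_gt0 : 0 < 2 * pi :> R.
Proof. by rewrite mulr_gt0// pi_gt0. Qed.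
Let P0 := twopi_gt0.

Lemma kernel_per t : K (t + 2 * pi) = K t.
Proof. by case: sK => [[]]. Qed.

Lemma kernel_perN t : K (t - 2 * pi) = K t.
Proof. by rewrite -kernel_per subrK. Qed.

Lemma kernel_2pi : K (2 * pi) = K 0.
Proof. by rewrite -[2 * pi]add0r kernel_per. Qed.

Lemma kernel_per_int (z : int) t : K (t + 2 * pi * z%:~R) = K t.
Proof.
have pern m u : K (u + 2 * pi * m%:R) = K u.
  elim: m u => [|m IH] u; first by rewrite mulr0 addr0.
  by rewrite -(natr1 m) mulrDr mulr1 addrA kernel_per IH.
case: z => m; first exact: pern.
by rewrite NegzE mulrNz mulrN -(pern m.+1 (t - _)) subrK.
Qed.

Lemma period_repr (t : R) : exists z : int, 0 <= t - 2 * pi * z%:~R < 2 * pi.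
Proof.
exists (Num.floor (t / (2 * pi))).
have := floor_itv (t / (2 * pi)).
rewrite ler_pdivlMr// ltr_pdivrMr// intrD mulrDl mul1r => /andP[h1 h2].
by apply/andP; split; rewrite mulrC; lra.
Qed.

Lemma kernel_fin t : 0 < t < 2 * pi -> K t \is a fin_num.
Proof. by case: sK => [[_ [+ _]] _]; exact. Qed.

Lemma kernel_ltey t : (K t < +oo)%E.
Proof.
have [z] := period_repr t.
have -> : K t = K (t - 2 * pi * z%:~R).
  by rewrite -[in LHS](subrK (2 * pi * z%:~R) t) kernel_per_int.
set u := t - _; rewrite le_eqVlt => /andP[/predU1P[<-|u0] uP].
  by case: sK => [[_ [_ [_ [L [Loo [_ [_ ->]]]]]]] _]; rewrite lt_neqAle Loo leey.
by rewrite ltey_eq kernel_fin// u0.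
Qed.

Lemma kernel_strictly_concave_open : strictly_concave_on `]0, 2 * pi[%classic k.
Proof.
move=> u m v; rewrite /= !in_itv/= => u0 v0 um mv.
have vu : 0 < v - u by lra.
case: sK => _ /(_ u v ((v - m) / (v - u)) u0 v0).
have -> : 1 - (v - m) / (v - u) = (m - u) / (v - u).
  by field; rewrite lt0r_neq0.
have -> : (v - m) / (v - u) * u + (m - u) / (v - u) * v = m.
  by field; rewrite lt0r_neq0.
rewrite lt_eqF; last exact: lt_trans mv.
have l01 : 0 < (v - m) / (v - u) < 1.
  have vm : 0 < v - m by lra.
  by apply/andP; split; [exact: divr_gt0|rewrite ltr_pdivrMr// mul1r; lra].
move=> /(_ isT l01).
rewrite !(mulrAC _ (_^-1)) -mulrDl ltr_pdivrMr// => h; lra.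
Qed.

Lemma kernel_cvg0 : K t @[t --> 0^'+] --> K 0.
Proof. by case: sK => [[_ [_ [_ [L [_ [? [_ ->]]]]]]] _]. Qed.

Lemma kernel_cvg2pi : K t @[t --> (2 * pi)^'-] --> K 0.
Proof. by case: sK => [[_ [_ [_ [L [_ [_ [? ->]]]]]]] _]. Qed.

(** Continuity is meant in the extended reals, so [K 0] may be [-oo]. Concavity gives it inside the
    period; at 0 the left limit is the limit at [2 * pi] moved by one period; the other points
    follow by translation. *)
Lemma kernel_continuous : continuous K.
Proof.
have contI t : 0 < t < 2 * pi -> K x @[x --> t] --> K t.
  move=> t0; rewrite -(fineK (kernel_fin t0)); apply/fine_cvgP; split.
    case/andP: t0 => t0 tP; near=> x; apply: kernel_fin; apply/andP; split.
    - by near: x; exact: lt_nbhsr.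
    - by near: x; exact: lt_nbhsl.
  exact: (strictly_concave_continuous kernel_strictly_concave_open).
have cont0 : K x @[x --> (0 : R)] --> K 0.
  apply/left_right_continuousP; split; last exact: kernel_cvg0.
  move=> U /kernel_cvg2pi; rewrite /nbhs/= /fmap/= /at_left/= /within/=.
  move=> /nbhs_ballP[e /= e0 eU]; apply/nbhs_ballP; exists e => //= x xe x0.
  rewrite -kernel_per; apply: eU; last by lra.
  by move: xe; rewrite /ball/= (_ : 2 * pi - (x + 2 * pi) = 0 - x)//; ring.
move=> t; have [z /andP[]] := period_repr t.
set c := 2 * pi * _; rewrite le_eqVlt => tz0 tzP.
have -> : K = (fun x => K (x - c)).
  by apply/funext => x; rewrite -[in LHS](subrK c x) kernel_per_int.
apply: (@cvg_comp _ _ _ (fun x => x - c) K _ (nbhs (t - c))).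
  by apply: cvgB; [exact: cvg_id|exact: cvg_cst].
case/predU1P: tz0 => [<-//|tz0]; apply: contI; exact/andP.
Unshelve. all: by end_near. Qed.

(* The endpoints are included exactly when the common limit is finite. *)
Definition kernel_dom : set R := [set u | 0 <= u <= 2 * pi /\ K u \is a fin_num].

Lemma kernel_dom_open u : 0 < u < 2 * pi -> kernel_dom u.
Proof.
by move=> u0; split; [case/andP: u0 => ? ?; rewrite !ltW|exact: kernel_fin].
Qed.

Lemma kernel_dom_between u v m : kernel_dom u -> kernel_dom v ->
  u < m -> m < v -> 0 < m < 2 * pi.
Proof.
move=> [/andP[u0 _] _] [/andP[_ vP] _] um mv.
by rewrite (le_lt_trans u0 um) (lt_le_trans mv vP).
Qed.

(** Passing to the limit at a finite endpoint yields only the weak inequality. Strictness is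
    recovered from the strict inequality in the open period at the midpoints of [[u, m]] and
    [[m, v]], combined with the weak one on each half. *)
Lemma kernel_strictly_concave : strictly_concave_on kernel_dom k.
Proof.
pose weak u m v := (v - m) * k u + (m - u) * k v <= (v - u) * k m.
have oo u m v : 0 < u -> u < m -> m < v -> v < 2 * pi -> weak u m v.
  move=> u0 um mv vP; apply/ltW/kernel_strictly_concave_open => //.
  - by rewrite /= in_itv/=; apply/andP; split; lra.
  - by rewrite /= in_itv/=; apply/andP; split; lra.
have co u m v : kernel_dom u -> u < m -> m < v -> v < 2 * pi -> weak u m v.
  move=> [/andP[]]; rewrite le_eqVlt => /predU1P[<- _ f0|u0 _ _]; last exact: oo.
  move=> m0 mv vP.
  have c00 : x @[x --> (0 : R)^'+] --> (0 : R) by exact: cvg_at_right_filter.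
  have c0 : k x @[x --> 0^'+] --> k 0.
    by apply: fine_cvg; rewrite fineK//; exact: kernel_cvg0.
  rewrite /weak; apply: (@ler_cvg_to R (0 : R)^'+ _ R
    (fun x => (v - m) * k x + (m - x) * k v) (fun x => (v - x) * k m)).
  - exact: (cvgD (cvgM (cvg_cst _) c0) (cvgM (cvgB (cvg_cst _) c00) (cvg_cst _))).
  - exact: (cvgM (cvgB (cvg_cst _) c00) (cvg_cst _)).
  - by near=> x; exact: oo.
have cc u m v : kernel_dom u -> kernel_dom v -> u < m -> m < v -> weak u m v.
  move=> Du [/andP[_]]; rewrite le_eqVlt => /predU1P[-> fP|vP _ um mv]; last exact: co.
  move=> um mP.
  have cPP : x @[x --> (2 * pi)^'-] --> (2 * pi : R) by exact: cvg_at_left_filter.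
  have cP : k x @[x --> (2 * pi)^'-] --> k (2 * pi).
    by apply: fine_cvg; rewrite fineK// kernel_2pi; exact: kernel_cvg2pi.
  rewrite /weak; apply: (@ler_cvg_to R (2 * pi)^'- _ R
    (fun x => (x - m) * k u + (m - u) * k x) (fun x => (x - u) * k m)).
  - exact: (cvgD (cvgM (cvgB cPP (cvg_cst _)) (cvg_cst _)) (cvgM (cvg_cst _) cP)).
  - exact: (cvgM (cvgB cPP (cvg_cst _)) (cvg_cst _)).
  - by near=> x; exact: co.
move=> u m v Du Dv um mv.
pose u1 := (u + m) / 2; pose v1 := (m + v) / 2.
have mI := kernel_dom_between Du Dv um mv.
have [uu1 u1m mv1 v1v] : [/\ u < u1, u1 < m, m < v1 & v1 < v].
  by rewrite /u1 /v1; split; lra.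
have Dm := kernel_dom_open mI.
have /(_ _ _)/wrap[] := kernel_strictly_concave_open _ _ u1m mv1.
- by rewrite /= in_itv/=; exact: (kernel_dom_between Du Dm).
- by rewrite /= in_itv/=; exact: (kernel_dom_between Dm Dv).
have := cc _ _ _ Du Dm uu1 u1m; have := cc _ _ _ Dm Dv mv1 v1v.
rewrite /weak.
have -> : v - v1 = (v - m) / 2 by rewrite /v1; lra.
have -> : v1 - m = (v - m) / 2 by rewrite /v1; lra.
have -> : m - u1 = (m - u) / 2 by rewrite /u1; lra.
have -> : u1 - u = (m - u) / 2 by rewrite /u1; lra.
have -> : v1 - u1 = (v - u) / 2 by rewrite /u1 /v1; lra.
have mu0 : 0 < m - u by lra.
have vm0 : 0 < v - m by lra.
set A := k u1; set B := k v1 => h1 h2 h3.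
have {}h1 : k m + k v <= 2 * B.
  rewrite -(ler_pM2l vm0); lra.
have {}h2 : k u + k m <= 2 * A.
  rewrite -(ler_pM2l mu0); lra.
have := ler_wpM2l (ltW vm0) h2; have := ler_wpM2l (ltW mu0) h1.
move=> *; lra.
Unshelve. all: by end_near. Qed.

(** The case [a = b] has to be covered, since two configurations may share some of the differences
    between [t] and a node; hence the separate strict clause. *)
Lemma kernel_conv (a b l : R) : kernel_dom a -> kernel_dom b -> 0 < l < 1 ->
  [/\ kernel_dom (l * a + (1 - l) * b),
      l * k a + (1 - l) * k b <= k (l * a + (1 - l) * b) &
      a != b -> l * k a + (1 - l) * k b < k (l * a + (1 - l) * b)].
Proof.
move=> Da Db /andP[l0 l1].
suff strict : a != b -> kernel_dom (l * a + (1 - l) * b) /\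
    l * k a + (1 - l) * k b < k (l * a + (1 - l) * b).
  have [<-|ab] := eqVneq a b; first by rewrite -!mulrDl !subrKC !mul1r.
  by have [? h] := strict ab; split=> //; exact: ltW.
wlog ab : a b l Da Db l0 l1 / a < b => [th|_].
  rewrite neq_lt => /orP[ab|ba]; first by apply: th => //; rewrite lt_eqF.
  have := th b a (1 - l) Db Da; rewrite subKr ![_ * b + _]addrC ![_ * k b + _]addrC.
  by apply=> //; [lra|lra|rewrite lt_eqF].
set m := l * a + _.
have am : a < m.
  rewrite -subr_gt0 (_ : m - a = (1 - l) * (b - a)); last by rewrite /m; ring.
  by rewrite mulr_gt0 ?subr_gt0.
have mb : m < b.
  rewrite -subr_gt0 (_ : b - m = l * (b - a)); last by rewrite /m; ring.
  by rewrite mulr_gt0 ?subr_gt0.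
split; first exact/kernel_dom_open/(kernel_dom_between Da Db).
have ba0 : 0 < b - a by lra.
have := kernel_strictly_concave Da Db am mb.
rewrite (_ : m - a = (1 - l) * (b - a)); last by rewrite /m; ring.
rewrite (_ : b - m = l * (b - a)); last by rewrite /m; ring.
by move=> h; rewrite -(ltr_pM2l ba0); lra.
Qed.

End Kernel.

(** * Small increments of the kernel when [K 0] is finite, the only case in which a maximum could
    sit at a node *)

Section FiniteKernel.
Variables (R : realType) (K : R -> \bar R).
Hypothesis sK : strictly_concave_kernel K.
Hypothesis K0fin : K 0 \is a fin_num.
Local Notation k := (kfin K).
Let P0 := twopi_gt0 R.

Lemma kfin_per_int (z : int) t : k (t + 2 * pi * z%:~R) = k t.
Proof. by rewrite /kfin kernel_per_int. Qed.

Lemma kfin_2pi : k (2 * pi) = k 0.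
Proof. by rewrite /kfin kernel_2pi. Qed.

Lemma kernel_finite t : K t \is a fin_num.
Proof.
have [z] := period_repr t; rewrite le_eqVlt => /andP[z0 zP].
rewrite -[t](subrK (2 * pi * z%:~R)) kernel_per_int//.
by case/predU1P : z0 => [<-//|z0]; apply: kernel_fin; rewrite ?z0.
Qed.

Lemma kernel_dom_closed u : 0 <= u <= 2 * pi -> kernel_dom K u.
Proof. by move=> u0; split=> //; exact: kernel_finite. Qed.

Let slope a b := (k b - k a) / (b - a).

(** The intervals may overlap. The comparison goes through [[a, d]]: moving either end of a chord to
    the right does not increase its slope. *)
Lemma kfin_slope_nincr a b c d : 0 <= a -> a < b -> c < d -> d <= 2 * pi ->
  a <= c -> b <= d -> slope c d <= slope a b.
Proof.
move=> a0 ab cd dP ac bd.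
have H := kernel_strictly_concave sK.
have Da : kernel_dom K a by apply: kernel_dom_closed; apply/andP; split; lra.
have Db : kernel_dom K b by apply: kernel_dom_closed; apply/andP; split; lra.
have Dc : kernel_dom K c by apply: kernel_dom_closed; apply/andP; split; lra.
have Dd : kernel_dom K d by apply: kernel_dom_closed; apply/andP; split; lra.
have ad : a < d by lra.
apply: (@le_trans _ _ (slope a d)).
  have [->//|ac'] := eqVneq c a.
  have {}ac : a < c by rewrite lt_neqAle eq_sym ac'.
  have := H _ _ _ Da Dd ac cd.
  by rewrite /slope ler_pdivrMr ?subr_gt0// mulrAC ler_pdivlMr ?subr_gt0// => ?; lra.
have [->//|bd'] := eqVneq b d.
have {}bd : b < d by rewrite lt_neqAle bd'.
have := H _ _ _ Da Dd ab bd.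
by rewrite /slope ler_pdivrMr ?subr_gt0// mulrAC ler_pdivlMr ?subr_gt0// => ?; lra.
Qed.

(** The chord over the whole period is horizontal because [K] takes the same value at both ends. *)
Lemma kfin0_lt t : 0 < t < 2 * pi -> k 0 < k t.
Proof.
move=> /andP[t0 tP].
have D0 : kernel_dom K 0 by apply: kernel_dom_closed; rewrite lexx ltW.
have DP : kernel_dom K (2 * pi) by apply: kernel_dom_closed; rewrite lexx ltW.
have := kernel_strictly_concave sK D0 DP t0 tP.
by rewrite kfin_2pi !subr0 -mulrDl subrK ltr_pM2l.
Qed.

(** [cond_inf'] constrains only derivatives that exist, so existence must be supplied: the
    difference quotients are monotone in [h] and bounded by chord slopes. *)
Lemma kernel_rderiv t : 0 < t < 2 * pi -> exists l,
  [/\ is_rderiv k t l, slope t (2 * pi) <= l & l <= slope 0 t].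
Proof.
move=> /andP[t0 tP].
pose f h := (k (t + h) - k t) / h.
have fE h : f h = slope t (t + h) by rewrite /f /slope addrAC subrr add0r.
pose A := f @` [set` Interval (BRight 0) (BLeft (2 * pi - t))].
have ubA : ubound A (slope 0 t).
  move=> _ [h /= + <-]; rewrite in_itv/= => /andP[h0 hP].
  by rewrite fE; apply: kfin_slope_nincr => //; lra.
exists (sup A); split.
- apply: nonincreasing_at_right_cvgr; first by rewrite bnd_simp; lra.
  + move=> h1 h2; rewrite !in_itv/= => /andP[h10 h1P] /andP[h20 h2P] h12.
    by rewrite -/(f h1) -/(f h2) !fE; apply: kfin_slope_nincr => //; lra.
  + by exists (slope 0 t).
- have Ah : A (f ((2 * pi - t) / 2)).
    by exists ((2 * pi - t) / 2) => //=; rewrite in_itv/=; apply/andP; split; lra.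
  apply: le_trans (ub_le_sup _ Ah); last by exists (slope 0 t).
  by rewrite fE; apply: kfin_slope_nincr => //; lra.
- apply: ge_sup => //; exists (f ((2 * pi - t) / 2)).
  by exists ((2 * pi - t) / 2) => //=; rewrite in_itv/=; apply/andP; split; lra.
Qed.

Lemma right_increment_ge th : exists C, \forall h \near 0^'+,
  C * h <= k (th + h) - k th.
Proof.
have [z] := period_repr th; set t := th - _ => /andP[t0 tP].
exists (slope t (2 * pi)); near=> h.
have h0 : 0 < h by near: h; exact: nbhs_right_gt.
have hP : h < 2 * pi - t by near: h; apply: nbhs_right_lt; rewrite subr_gt0.
have -> : th + h = t + h + 2 * pi * z%:~R by rewrite /t addrAC subrK.
rewrite -[in X in _ - X](subrK (2 * pi * z%:~R) th) !kfin_per_int -/t.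
rewrite -ler_pdivlMr// [leRHS](_ : _ = slope t (t + h)).
  by apply: kfin_slope_nincr => //; lra.
by rewrite /slope (_ : t + h - t = h)//; ring.
Unshelve. all: by end_near. Qed.

Lemma left_increment_ge th : exists C, \forall h \near 0^'+,
  C * h <= k (th - h) - k th.
Proof.
have [z] := period_repr th; set t := th - _ => /andP[t0 tP].
(* The representative is taken in [(0, 2 * pi]] to leave room on its left. *)
have [u [w [-> u0 uP]]] : exists u, exists w : int,
    [/\ th = u + 2 * pi * w%:~R, 0 < u & u <= 2 * pi].
  have [t00|t00] := eqVneq t 0.
    exists (2 * pi), (z - 1); split=> //; rewrite intrB mulrBr mulr1 subrKC.
    by apply/eqP; rewrite -subr_eq0 -/t t00.
  by exists t, z; split; [rewrite subrK|rewrite lt_neqAle eq_sym t00|exact: ltW].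
exists (- slope 0 u); near=> h.
have h0 : 0 < h by near: h; exact: nbhs_right_gt.
have hP : h < u by near: h; exact: nbhs_right_lt.
rewrite addrAC !kfin_per_int mulNr lerNl opprB.
rewrite -ler_pdivrMr// [leLHS](_ : _ = slope (u - h) u).
  by apply: kfin_slope_nincr => //; lra.
by rewrite /slope subKr.
Unshelve. all: by end_near. Qed.

(** The chord from 0 to [h] has slope at least the right derivative at [h], which exceeds any [M]
    for small [h]. *)
Lemma increment0_ge (M : R) :
  (forall M : R, \forall t \near 0^'+, forall l,
      (is_rderiv k t l \/ is_lderiv k t l) -> M <= l) ->
  \forall h \near 0^'+, M * h <= k (0 + h) - k 0.
Proof.
move=> /(_ M) HM; near=> h.
have h0 : 0 < h by near: h; exact: nbhs_right_gt.
have hP : h < 2 * pi by near: h; exact: nbhs_right_lt.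
have [|l [dl _ lh]] := @kernel_rderiv h; first by rewrite h0.
have HMh : forall l, is_rderiv k h l \/ is_lderiv k h l -> M <= l by near: h.
have Ml : M <= l by apply: HMh; left.
by rewrite add0r -ler_pdivlMr// (le_trans Ml)// (le_trans lh)// /slope subr0.
Unshelve. all: by end_near. Qed.

(** Mirror image at the other end of the period: the chord from [t] to [2 * pi] has slope at most
    the right derivative at [t], and periodicity carries the estimate to the left of 0. *)
Lemma decrement0_ge (M : R) :
  (forall M : R, \forall t \near (2 * pi)^'-, forall l,
      (is_rderiv k t l \/ is_lderiv k t l) -> l <= M) ->
  \forall h \near 0^'+, M * h <= k (0 - h) - k 0.
Proof.
move=> /(_ (- M)) HM.
have : \forall t \near (2 * pi)^'-, M * (2 * pi - t) <= k t - k 0.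
  near=> t.
  have t0 : 0 < t by near: t; exact: nbhs_left_gt.
  have tP : t < 2 * pi by near: t; exact: nbhs_left_lt.
  have [|l [dl lh _]] := @kernel_rderiv t; first by rewrite t0.
  have HMt : forall l, is_rderiv k t l \/ is_lderiv k t l -> l <= - M by near: t.
  have Ml : l <= - M by apply: HMt; left.
  move: (le_trans lh Ml).
  rewrite /slope ler_pdivrMr ?subr_gt0// kfin_2pi; lra.
rewrite /at_left /at_right !near_withinE => /nbhs_ballP[e /= e0 He].
apply/nbhs_ballP; exists e => //= h he h0.
have -> : k (0 - h) = k (2 * pi - h) by rewrite sub0r addrC /kfin kernel_per.
rewrite -[h in M * h](subKr (2 * pi)); apply: He; last by lra.
by move: he; rewrite /ball/= sub0r normrN subKr.
Unshelve. all: by end_near. Qed.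

(** At a point of differentiability the two first-order terms cancel, leaving [o(h)]. At multiples
    of the period both increments are positive, as [K 0] is the strict minimum. *)
Lemma derivable_sym_increment_ge th (e : R) : 0 < e ->
  (forall t, 0 < t < 2 * pi -> derivable k t 1) ->
  \forall h \near 0^'+, - e * h <= (k (th + h) - k th) + (k (th - h) - k th).
Proof.
move=> e0 dk; have [z] := period_repr th; set t := th - _ => /andP[t0 tP].
have -> : th = t + 2 * pi * z%:~R by rewrite subrK.
move: t t0 tP => {th} t; rewrite le_eqVlt => /predU1P[<- _|t0 tP].
  near=> h.
  have h0 : 0 < h by near: h; exact: nbhs_right_gt.
  have hP : h < 2 * pi by near: h; exact: nbhs_right_lt.
  rewrite !(addrAC _ (2 * pi * _)) !kfin_per_int sub0r add0r.
  have -> : k (- h) = k (2 * pi - h) by rewrite addrC /kfin kernel_per.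
  have k1 : k 0 < k h by apply: kfin0_lt; rewrite h0.
  have k2 : k 0 < k (2 * pi - h) by apply: kfin0_lt; apply/andP; split; lra.
  have := mulr_gt0 e0 h0; lra.
have /cvg_ex[d /= Hd] : derivable k t 1 by apply: dk; rewrite t0.
have : \forall h \near 0^', `|d - h^-1 * (k (h + t) - k t)| <= e / 2.
  move/cvgrPdist_le : Hd => /(_ (e / 2)); rewrite divr_gt0// => /(_ isT).
  by apply: filterS => h; rewrite [h *: _]mulr1.
rewrite near_withinE => /nbhs_ballP[r /= r0 Hr].
rewrite near_withinE; apply/nbhs_ballP; exists r => //= h hr h0.
rewrite !(addrAC _ (2 * pi * _)) !kfin_per_int.
have hN : ball 0 r (- h) by move: hr; rewrite /ball/= !sub0r !normrN.
have := Hr _ hr (lt0r_neq0 h0).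
have /(Hr _ hN) : - h != 0 by rewrite oppr_eq0 lt0r_neq0.
rewrite invrN mulNr !ler_norml ![_ + t]addrC.
move=> /andP[a1 a2] /andP[b1 b2].
have -> : k (t + h) - k t = (h^-1 * (k (t + h) - k t)) * h.
  by rewrite mulrAC mulVf ?mul1r// lt0r_neq0.
have -> : k (t - h) - k t = (h^-1 * (k (t - h) - k t)) * h.
  by rewrite mulrAC mulVf ?mul1r// lt0r_neq0.
rewrite -mulrDl ler_pM2r//; lra.
Unshelve. all: by end_near. Qed.

(** The kernel has a corner pointing down at 0: the right increment is at least [h] times the slope
    over [[0, pi]], and the left increment is positive. *)
Lemma sym_increment0_ge : exists2 c, 0 < c &
  \forall h \near 0^'+, c * h <= (k (0 + h) - k 0) + (k (0 - h) - k 0).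
Proof.
have pP : pi < 2 * pi :> R by have := pi_gt0 R; lra.
exists (slope 0 pi).
  by rewrite /slope divr_gt0 ?subr0 ?pi_gt0// subr_gt0 kfin0_lt// pi_gt0.
near=> h.
have h0 : 0 < h by near: h; exact: nbhs_right_gt.
have hP : h < pi by near: h; apply: nbhs_right_lt; exact: pi_gt0.
have k2 : k 0 < k (2 * pi - h) by apply: kfin0_lt; apply/andP; split; lra.
have -> : k (0 - h) = k (2 * pi - h) by rewrite sub0r addrC /kfin kernel_per.
have : slope 0 pi <= slope 0 h by apply: kfin_slope_nincr => //; lra.
rewrite {2}/slope subr0 ler_pdivlMr// add0r => *; lra.
Unshelve. all: by end_near. Qed.

End FiniteKernel.

(* Nodes are sequences [nat -> R] of which only the first [n.+1] terms matter. *)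
Definition tsum (R : realType) (K : R -> \bar R) n (rho x : nat -> R) (t : R) :
  \bar R := (\sum_(j < n.+1) ((rho j)%:E * K (t - x j)%R))%E.

Definition tsup (R : realType) (K : R -> \bar R) n (rho x : nat -> R) : \bar R :=
  ereal_sup (range (tsum K n rho x)).

Definition cyc_sorted (R : realType) n (x : nat -> R) :=
  (forall j, (j < n)%N -> x j <= x j.+1) /\ x n <= x 0%N + 2 * pi.

Definition next_node (R : realType) n (x : nat -> R) j : R :=
  if (j < n)%N then x j.+1 else x 0%N + 2 * pi.

(** * Cyclically ordered nodes and the arcs between them *)

Section Nodes.
Variables (R : realType) (n : nat).
Implicit Types (x : nat -> R).
Let P0 := twopi_gt0 R.

Lemma cyc_sorted_le x i j : cyc_sorted n x -> (i <= j <= n)%N -> x i <= x j.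
Proof.
move=> [sx _] /andP[ij jn]; elim: j ij jn => [|j IH].
  by rewrite leqn0 => /eqP->.
rewrite leq_eqVlt => /predU1P[->//|ij] jn.
by apply: le_trans (IH _ (ltnW jn)) (sx _ jn).
Qed.

Lemma cyc_sorted_next x j : cyc_sorted n x -> (j <= n)%N -> x j <= next_node n x j.
Proof.
move=> cx jn; rewrite /next_node; case: ltnP => [jn'|nj]; first exact: cx.1.
have -> : j = n by apply/eqP; rewrite eqn_leq jn.
exact: cx.2.
Qed.

Lemma cyc_sorted_next_le x i j : cyc_sorted n x -> (j < i <= n)%N ->
  next_node n x j <= x i.
Proof.
move=> cx /andP[ji iN]; rewrite /next_node (leq_trans ji iN).
by apply: cyc_sorted_le => //; rewrite ji.
Qed.

Lemma cyc_sorted_next_2pi x i j : cyc_sorted n x -> (i <= j <= n)%N ->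
  next_node n x j <= x i + 2 * pi.
Proof.
move=> cx /andP[ij jn]; rewrite /next_node.
have x0i : x 0%N <= x i by apply: cyc_sorted_le => //; rewrite /= (leq_trans ij).
case: ltnP => [jn'|_]; last by rewrite lerD2r.
have : x j.+1 <= x n by apply: cyc_sorted_le => //; rewrite jn' leqnn.
have := cx.2; lra.
Qed.

(* For [t] in the [j]-th arc, [t - x i + arc_shift i j] is the representative of
   [t - x i] in [0, 2 pi]; it is affine in [(x, t)] on the whole arc. *)
Definition arc_shift i j : R := if (i <= j)%N then 0 else 2 * pi.

Lemma arc_shift_itv x i j t : cyc_sorted n x -> (i <= n)%N -> (j <= n)%N ->
  x j <= t <= next_node n x j -> 0 <= t - x i + arc_shift i j <= 2 * pi.
Proof.
move=> cx iN jN /andP[jt tj]; rewrite /arc_shift; case: leqP => ij.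
  have := @cyc_sorted_le x i j cx; rewrite ij jN => /(_ isT).
  have := @cyc_sorted_next_2pi x i j cx; rewrite ij jN => /(_ isT).
  by move=> *; apply/andP; split; lra.
have := @cyc_sorted_next_le x i j cx; rewrite ij iN => /(_ isT).
have := @cyc_sorted_le x 0 j cx; rewrite jN => /(_ isT).
have := @cyc_sorted_le x i n cx; rewrite iN leqnn => /(_ isT).
have := cx.2.
by move=> *; apply/andP; split; lra.
Qed.

(** An interior point can be moved by [e] both ways within the arc; the closed bounds at the two
    moved points give strict bounds at [t]. *)
Lemma arc_shift_itv_open x i j t : cyc_sorted n x -> (i <= n)%N -> (j <= n)%N ->
  x j < t < next_node n x j -> 0 < t - x i + arc_shift i j < 2 * pi.
Proof.
move=> cx iN jN /andP[jt tj].
have e0 : 0 < Num.min (t - x j) (next_node n x j - t) by rewrite lt_min !subr_gt0 jt.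
set e := Num.min _ _ in e0.
have e1 : e <= t - x j by rewrite ge_min lexx.
have e2 : e <= next_node n x j - t by rewrite ge_min lexx orbT.
have /andP[h1 _] : 0 <= t - e - x i + arc_shift i j <= 2 * pi.
  by apply: arc_shift_itv => //; apply/andP; split; lra.
have /andP[_ h2] : 0 <= t + e - x i + arc_shift i j <= 2 * pi.
  by apply: arc_shift_itv => //; apply/andP; split; lra.
by apply/andP; split; lra.
Qed.

Lemma arc_cover x t : cyc_sorted n x -> x 0%N <= t <= x 0%N + 2 * pi ->
  exists2 j, (j <= n)%N & x j <= t <= next_node n x j.
Proof.
move=> cx /andP[t0 tP].
have ex : exists j, (j <= n)%N && (x j <= t) by exists 0%N; rewrite t0.
have ub j : (j <= n)%N && (x j <= t) -> (j <= n)%N by case/andP.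
case: (ex_maxnP ex ub) => j /andP[jn jt] jmax; exists j => //.
rewrite jt /next_node/=; case: ltnP => // jn'.
rewrite leNgt; apply/negP => tj.
by have := jmax j.+1; rewrite jn' (ltW tj) ltnn => /(_ isT).
Qed.

Lemma arc_nondegenerate x : cyc_sorted n x ->
  exists2 j, (j <= n)%N & x j < next_node n x j.
Proof.
move=> cx; apply: contrapT => /forallPNP h.
have {}h j : (j <= n)%N -> next_node n x j <= x j.
  by move=> jn; rewrite leNgt; apply/negP; exact: h.
have xn0 : x n <= x 0%N.
  have : forall j, (j <= n)%N -> x j <= x 0%N.
    elim=> // j IH jn; apply: le_trans (IH (ltnW jn)).
    by have := h j (ltnW jn); rewrite /next_node jn.
  by apply.
by have := P0; have := h n (leqnn n); rewrite /next_node ltnn; lra.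
Qed.

End Nodes.

(** * Sums of translates: continuity, attained maxima, and no maximum at a node *)

Section TranslateSum.
Variables (R : realType) (K : R -> \bar R).
Hypothesis sK : strictly_concave_kernel K.
Variables (n : nat) (rho : nat -> R).
Hypothesis rho0 : forall j, 0 < rho j.
Implicit Types (x : nat -> R).
Local Notation k := (kfin K).
Local Notation F := (tsum K n rho).
Local Notation H := (tsup K n rho).
Let P0 := twopi_gt0 R.

Let term_ltey j u : ((rho j)%:E * K u < +oo)%E.
Proof.
have := kernel_ltey sK u; case: (K u) => [r||]// _; first by rewrite -EFinM ltry.
by rewrite gt0_muleNy ?lte_fin.
Qed.

Let term_cvg (T : Type) (G : set_system T) (FG : Filter G) (f : T -> nat -> R)
    (g : T -> R) x t m : (forall j, f z j @[z --> G] --> x j) ->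
  g z @[z --> G] --> t ->
  (\sum_(j < m) ((rho j)%:E * K (g z - f z j)%R))%E @[z --> G] -->
  (\sum_(j < m) ((rho j)%:E * K (t - x j)%R))%E.
Proof.
move=> fx gt; elim: m => [|m IH].
  by under eq_fun do rewrite big_ord0; rewrite big_ord0; exact: cvg_cst.
rewrite big_ord_recr/=; under eq_fun do rewrite big_ord_recr/=.
apply: cvgeD => //.
  (* No term is ever [+oo], so the extended sum is never indeterminate. *)
  by apply: ltpinfty_adde_def; rewrite inE// lte_sum_pinfty.
apply: cvgeZl => //.
apply: (@cvg_comp _ _ _ (fun z => g z - f z m) K _ (nbhs (t - x m))).
  exact: cvgB.
exact: kernel_continuous.
Qed.

(** Joint continuity, stated along a filter in order to serve when [t] moves, when the nodes move,
    and when both do. *)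
Lemma tsum_cvg (T : Type) (G : set_system T) (FG : Filter G) (f : T -> nat -> R)
    (g : T -> R) x t : (forall j, f z j @[z --> G] --> x j) ->
  g z @[z --> G] --> t -> F (f z) (g z) @[z --> G] --> F x t.
Proof. by move=> fx gt; exact: term_cvg. Qed.

Lemma tsum_continuous x : continuous (F x).
Proof.
move=> t; apply: (@tsum_cvg _ _ _ (fun=> x) id) => [j|]; first exact: cvg_cst.
exact: cvg_id.
Qed.

Lemma tsum_ltey x t : (F x t < +oo)%E.
Proof.
by apply: lte_sum_pinfty => j _; exact: term_ltey.
Qed.

Lemma tsumE x t : (forall j, (j <= n)%N -> K (t - x j) \is a fin_num) ->
  F x t = (\sum_(j < n.+1) rho j * k (t - x j))%:E.
Proof.
move=> Kfin; rewrite /tsum -sumEFin; apply: eq_bigr => j _.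
by rewrite EFinM fineK// Kfin// -ltnS.
Qed.

Lemma tsum_gtNy x t j : (-oo < F x t)%E -> (j <= n)%N -> K (t - x j) \is a fin_num.
Proof.
rewrite -ltnS => Ft jn.
rewrite fin_numElt kernel_ltey// andbT ltNge leeNy_eq; apply: contraTN Ft => /eqP Kj.
by rewrite -leNgt leeNy_eq /tsum (bigD1 (Ordinal jn))//= Kj gt0_muleNy ?lte_fin.
Qed.

Lemma tsum_per_int x t (z : int) : F x (t + 2 * pi * z%:~R) = F x t.
Proof. by apply: eq_bigr => j _; rewrite addrAC kernel_per_int. Qed.

Lemma tsum_le_tsup x t : (F x t <= H x)%E.
Proof. by apply: ereal_sup_ubound; exists t. Qed.

Lemma tsum_repr x a t : exists2 u, a <= u < a + 2 * pi & F x u = F x t.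
Proof.
have [z /andP[z0 zP]] := period_repr (t - a); exists (t - 2 * pi * z%:~R).
  by apply/andP; split; lra.
by rewrite -[in RHS](subrK (2 * pi * z%:~R) t) tsum_per_int.
Qed.

Lemma tsup_attained x a : exists2 t, a <= t <= a + 2 * pi & F x t = H x.
Proof.
have [|t /= ta tmax] := @compact_cont_max R R `[a, a + 2 * pi]%classic (F x)
  (@segment_compact _ _ _) _ (@tsum_continuous x).
  by exists a; rewrite /= in_itv/= lexx lerDl ltW.
rewrite in_itv/= in ta; exists t => //; apply/eqP; rewrite eq_le tsum_le_tsup/=.
apply: ge_ereal_sup => _ [u _ <-]; have [v /andP[av va] <-] := tsum_repr x a u.
by apply: tmax; rewrite /= in_itv/= av ltW.
Qed.

Lemma kernel_arc_shift u i j : K (u + arc_shift R i j) = K u.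
Proof. by rewrite /arc_shift; case: ifP => _; rewrite ?addr0 ?kernel_per. Qed.

(** At the midpoint of a nondegenerate arc no difference with a node is a multiple of the period, so
    every term is finite. *)
Lemma tsup_gtNy x : cyc_sorted n x -> (-oo < H x)%E.
Proof.
move=> cx; have [j jn xj] := arc_nondegenerate cx.
apply: lt_le_trans (tsum_le_tsup _ ((x j + next_node n x j) / 2)).
rewrite tsumE ?ltNyr// => i iN; rewrite -(kernel_arc_shift _ i j).
apply: kernel_fin => //; apply: (arc_shift_itv_open cx) => //.
by apply/andP; split; lra.
Qed.

Lemma tsup_fin x : cyc_sorted n x -> H x \is a fin_num.
Proof.
move=> cx; rewrite fin_numElt tsup_gtNy//=.
by have [t _ <-] := tsup_attained x 0; exact: tsum_ltey.
Qed.

(** Here [d th h] stands for a one-sided or symmetric increment of the kernel at [th], whose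
    weighted sum is nonpositive when [x j] is a maximum point. One small [h > 0] suits all the
    nodes, and dividing by it gives the bound. *)
Lemma lower_slopes_sum_le0 x j (d : R -> R -> R) (b : nat -> R) :
  (forall i, (i <= n)%N -> \forall h \near 0^'+, b i * h <= d (x j - x i) h) ->
  (forall h, \sum_(i < n.+1) rho i * d (x j - x i) h <= 0) ->
  \sum_(i < n.+1) rho i * b i <= 0.
Proof.
move=> db d0; rewrite leNgt; apply/negP => b0.
have : \forall h \near 0^'+, forall i : 'I_n.+1, b i * h <= d (x j - x i) h.
  by apply: filter_forall => i; apply: db; rewrite -ltnS.
move=> dbn.
have [h [h0 dbh]] : exists h, 0 < h /\ forall i : 'I_n.+1, b i * h <= d (x j - x i) h.
  near (0 : R)^'+ => h; exists h; split.
    by near: h; exact: nbhs_right_gt.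
  by near: h.
have := d0 h; apply/negP; rewrite -ltNge.
apply: (@lt_le_trans _ _ ((\sum_(i < n.+1) rho i * b i) * h)); first exact: mulr_gt0.
rewrite mulr_suml; apply: ler_sum => i _; rewrite -mulrA ler_wpM2l//.
exact: ltW.
Unshelve. all: by end_near. Qed.

(** At a maximum at [x j], all weighted increments of the sum would be nonpositive. But the [j]-th
    term, seen at 0, has an increment that outweighs the lower bounds for the others: a one-sided
    one of arbitrarily large slope under [cond_inf'], a symmetric one of slope [c > 0] in the smooth
    case. *)
Lemma tsum_node_lt x j : cond_inf' K \/ C1_0_2pi K -> cyc_sorted n x ->
  (j <= n)%N -> (F x (x j) < H x)%E.
Proof.
move=> hK cx jn; rewrite ltNge; apply/negP => HF.
have Fj : (-oo < F x (x j))%E by apply: lt_le_trans HF; exact: tsup_gtNy.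
have K0 : K 0 \is a fin_num by rewrite -(subrr (x j)); exact: (tsum_gtNy Fj).
have fK := kernel_finite sK K0.
have max h : \sum_(i < n.+1) rho i * (k (x j - x i + h) - k (x j - x i)) <= 0.
  under eq_bigr do rewrite mulrBr.
  rewrite sumrB subr_le0 -lee_fin -tsumE//.
  apply: le_trans HF; rewrite [leLHS](_ : _ = F x (x j + h)) ?tsum_le_tsup//.
  by rewrite tsumE//; congr EFin; apply: eq_bigr => i _; rewrite addrAC.
pose j' := Ordinal (n := n.+1) (m := j) jn.
have sumj (c : nat -> R) (M : R) :
    \sum_(i < n.+1) rho i * (if i == j :> nat then M else c i) =
    rho j * M + \sum_(i < n.+1 | i != j') rho i * c i.
  rewrite (bigD1 j')//= eqxx; congr (_ + _); apply: eq_bigr => i ij.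
  by rewrite -[j]/(nat_of_ord j') val_eqE (negbTE ij).
have unbounded (d : R -> R -> R) :
    (forall th, exists C, \forall h \near 0^'+, C * h <= d th h) ->
    (forall M, \forall h \near 0^'+, M * h <= d 0 h) ->
    (forall h, \sum_(i < n.+1) rho i * d (x j - x i) h <= 0) -> False.
  move=> dC dM dle.
  pose C th := projT1 (cid (dC th)).
  have CP th : \forall h \near 0^'+, C th * h <= d th h by exact: projT2 (cid (dC th)).
  pose S := \sum_(i < n.+1 | i != j') rho i * C (x j - x i).
  (* With this [M] the weighted sum of the lower slopes equals 1. *)
  pose M := (1 - S) / rho j.
  have := @lower_slopes_sum_le0 x j d (fun i => if i == j then M else C (x j - x i)) _ dle.
  have -> := sumj (fun i => C (x j - x i)) M.
  have -> : rho j * M = 1 - S by rewrite /M mulrC mulfVK ?gt_eqF.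
  rewrite -/S subrK ler10 => /(_ _)/wrap[] // i iN.
  by case: eqP => [->|_]; [rewrite subrr; exact: dM|exact: CP].
case: hK => [[dP|d0]|c1].
- apply: (unbounded (fun th h => k (th - h) - k th)) => [th|M|h].
  + exact: left_increment_ge.
  + exact: decrement0_ge.
  + exact: (max (- h)).
- apply: (unbounded (fun th h => k (th + h) - k th)) => [th|M|h].
  + exact: right_increment_ge.
  + exact: increment0_ge.
  + exact: max.
pose d (th h : R) := (k (th + h) - k th) + (k (th - h) - k th).
have dle h : \sum_(i < n.+1) rho i * d (x j - x i) h <= 0.
  under eq_bigr do rewrite mulrDr.
  by rewrite big_split/=; have := max h; have := max (- h); lra.
have [c c0 dc] := sym_increment0_ge sK K0.
pose S := \sum_(i < n.+1 | i != j') rho i.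
have S0 : 0 <= S by apply: sumr_ge0 => i _; exact: ltW.
(* With this [e] the weighted sum of the lower slopes, [rho j * c - e * S], equals [e]. *)
pose e := rho j * c / (S + 1).
have S1 : 0 < S + 1 by rewrite ltr_wpDl.
have e0 : 0 < e by rewrite divr_gt0// mulr_gt0.
have := @lower_slopes_sum_le0 x j d (fun i => if i == j then c else - e) _ dle.
have -> := sumj (fun=> - e) c; rewrite -mulr_suml -/S mulrN.
have -> : rho j * c = e * (S + 1) by rewrite mulfVK// gt_eqF.
rewrite (_ : _ - _ = e); last by ring.
rewrite leNgt e0 => /(_ _)/wrap[] // i iN.
case: eqP => [->|_]; first by rewrite subrr; exact: dc.
apply: derivable_sym_increment_ge => // t t0.
by case: (c1 t t0).
Qed.

End TranslateSum.

Lemma cyc_sortedP (R : realType) n (x : nat -> R) :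
  cyc_sorted n x <-> forall j, (j <= n)%N -> x j <= next_node n x j.
Proof.
split=> [cx j jn|h]; first exact: cyc_sorted_next.
split=> [j jn|]; first by have := h j (ltnW jn); rewrite /next_node jn.
by have := h n (leqnn n); rewrite /next_node ltnn.
Qed.

Definition is_min (R : realType) (K : R -> \bar R) n (rho x : nat -> R) :=
  cyc_sorted n x /\
  forall z, cyc_sorted n z -> (tsup K n rho x <= tsup K n rho z)%E.

(** * Minimizers: existence, and a maximum on every arc *)

Section Minimizer.
Variables (R : realType) (K : R -> \bar R).
Hypothesis sK : strictly_concave_kernel K.
Variables (n : nat).
Implicit Types (x y rho : nat -> R).
Local Notation k := (kfin K).
Let P0 := twopi_gt0 R.

Section FixedWeights.
Variable rho : nat -> R.
Hypothesis rho0 : forall j, 0 < rho j.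
Local Notation F := (tsum K n rho).
Local Notation H := (tsup K n rho).

(** Both configurations use the same arc index [j], hence the same shifts: each term is the concave
    kernel composed with an affine map of nodes and point. Strictness comes either from the value at
    [y] or from one term with distinct arguments. *)
Lemma tsum_conv x y j t u l (mu : R) : cyc_sorted n x -> cyc_sorted n y ->
  (j <= n)%N -> x j <= t <= next_node n x j -> y j <= u <= next_node n y j ->
  0 < l < 1 -> (mu%:E <= F x t)%E -> (mu%:E <= F y u)%E ->
  (mu%:E < F y u)%E \/ (exists2 i, (i <= n)%N & t - x i != u - y i) ->
  (mu%:E < F (fun i => l * x i + (1 - l) * y i)%R (l * t + (1 - l) * u)%R)%E.
Proof.
move=> cx cy jn tj uj l01 Fx Fy strict.
have l0 : 0 < l by case/andP: l01.
have l1 : 0 < 1 - l by case/andP: l01; lra.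
have Kx i : (i <= n)%N -> K (t - x i) \is a fin_num.
  by apply: (tsum_gtNy sK rho0); apply: lt_le_trans Fx; exact: ltNyr.
have Ky i : (i <= n)%N -> K (u - y i) \is a fin_num.
  by apply: (tsum_gtNy sK rho0); apply: lt_le_trans Fy; exact: ltNyr.
have kshift v i : k (v + arc_shift R i j) = k v by rewrite /kfin kernel_arc_shift.
have Dx i : (i <= n)%N -> kernel_dom K (t - x i + arc_shift R i j).
  move=> iN; split; first exact: (arc_shift_itv cx).
  by rewrite kernel_arc_shift// Kx.
have Dy i : (i <= n)%N -> kernel_dom K (u - y i + arc_shift R i j).
  move=> iN; split; first exact: (arc_shift_itv cy).
  by rewrite kernel_arc_shift// Ky.
have argE i : l * (t - x i + arc_shift R i j) + (1 - l) * (u - y i + arc_shift R i j)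
    = l * t + (1 - l) * u - (l * x i + (1 - l) * y i) + arc_shift R i j by ring.
pose arg i := l * t + (1 - l) * u - (l * x i + (1 - l) * y i).
have term i : (i <= n)%N -> [/\ K (arg i) \is a fin_num,
    l * k (t - x i) + (1 - l) * k (u - y i) <= k (arg i) &
    t - x i != u - y i -> l * k (t - x i) + (1 - l) * k (u - y i) < k (arg i)].
  move=> iN; have [[_]] := kernel_conv sK (Dx i iN) (Dy i iN) l01.
  rewrite !argE !kshift kernel_arc_shift// => fi le lt; split=> // ne.
  by apply: lt; apply: contra ne => /eqP/addIr ->.
rewrite tsumE//; last by move=> i /term[].
move: Fx Fy strict; rewrite !tsumE// !lee_fin !lte_fin => mX mY strict.
rewrite -[ltRHS]/(\sum_(i < n.+1) rho i * k (arg i)).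
set X := \sum_(i < _) _ in mX; set Y := \sum_(i < _) _ in mY strict.
have XYE : l * X + (1 - l) * Y =
    \sum_(i < n.+1) rho i * (l * k (t - x i) + (1 - l) * k (u - y i)).
  by rewrite !mulr_sumr -big_split/=; apply: eq_bigr => i _; ring.
have lX := ler_wpM2l (ltW l0) mX; have lY := ler_wpM2l (ltW l1) mY.
case: strict => [mY'|[i iN ne]].
  have lY' : (1 - l) * mu < (1 - l) * Y by rewrite ltr_pM2l.
  apply: (@lt_le_trans _ _ (l * X + (1 - l) * Y)); first by lra.
  rewrite XYE; apply: ler_sum => i _; apply: ler_wpM2l; first exact: ltW.
  have iN : (i <= n)%N by rewrite -ltnS.
  by case: (term i iN).
apply: (@le_lt_trans _ _ (l * X + (1 - l) * Y)); first by lra.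
have iN' : (i < n.+1)%N by [].
rewrite XYE (bigD1 (Ordinal iN'))//= [ltRHS](bigD1 (Ordinal iN'))//= ltr_leD//.
  by rewrite ltr_pM2l//; have [_ _] := term i iN; exact.
apply: ler_sum => i' _; apply: ler_wpM2l; first exact: ltW.
have i'N : (i' <= n)%N by rewrite -ltnS.
by case: (term i' i'N).
Qed.

(** The arc from [x k1] to [x k2 + 2 * pi] is widened and [t] lies outside it. Put [u = t - x k2]
    and [w = t - x k1 + 2 * pi]; then [u <= w], so the chord over [[w, w + a]] has smaller slope
    than the one over [[u - b, u]]. As [rho k1 * a = rho k2 * b], the gain at [k1] is less than the
    loss at [k2]. *)
Lemma pull_apart_lt x k1 k2 (a b t : R) : (k1 <= n)%N -> (k2 <= n)%N -> k1 != k2 ->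
  x k1 <= x k2 + 2 * pi -> 0 < a -> 0 < b -> rho k1 * a = rho k2 * b ->
  x k2 + b <= t -> t <= x k1 - a ->
  let z j := if j == k2 then x j + b else if j == k1 then x j - a else x j in
  (-oo < F z t)%E -> (F z t < F x t)%E.
Proof.
move=> k1n k2n k12 x12 a0 b0 ab tb ta z Fz.
have Kz j : (j <= n)%N -> K (t - z j) \is a fin_num.
  by move=> jn; exact: (tsum_gtNy sK rho0 Fz).
pose u := t - x k2; pose w := t - x k1 + 2 * pi.
have z2 : t - z k2 = u - b by rewrite /z eqxx /u; ring.
have z1 : t - z k1 = w + a - 2 * pi by rewrite /z (negbTE k12) eqxx /w; ring.
have uw : u <= w by rewrite /u /w; lra.
have ub0 : 0 <= u - b by rewrite /u; lra.
have waP : w + a <= 2 * pi by rewrite /w; lra.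
have Du' : kernel_dom K (u - b).
  by split; [apply/andP; split; lra|rewrite -z2 Kz].
have Dw' : kernel_dom K (w + a).
  by split; [apply/andP; split; lra|rewrite -(kernel_perN sK) -z1 Kz].
have Du : kernel_dom K u by apply: kernel_dom_open => //; apply/andP; split; lra.
have Dw : kernel_dom K w by apply: kernel_dom_open => //; apply/andP; split; lra.
have Kx j : (j <= n)%N -> K (t - x j) \is a fin_num.
  move=> jn; have [->|j2] := eqVneq j k2; first by case: Du.
  have [->|j1] := eqVneq j k1; first by rewrite -(kernel_per sK); case: Dw.
  by have := Kz j jn; rewrite /z (negbTE j1) (negbTE j2).
rewrite !tsumE// lte_fin.
have k1n' : (k1 < n.+1)%N by []. have k2n' : (k2 < n.+1)%N by [].
rewrite (bigD1 (Ordinal k2n'))//= (bigD1 (Ordinal k1n'))//=.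
rewrite [ltRHS](bigD1 (Ordinal k2n'))//= [in ltRHS](bigD1 (Ordinal k1n'))//=.
rewrite [X in _ + (_ + X) < _](eq_bigr (fun i : 'I_n.+1 => rho i * k (t - x i)));
    last first.
  move=> i /andP[i2 i1]; rewrite /z -[k2]/(val (Ordinal k2n')).
  by rewrite -[k1]/(val (Ordinal k1n')) !val_eqE (negbTE i1) (negbTE i2).
have -> : k (t - z k1) = k (w + a) by rewrite z1 /kfin kernel_perN.
have -> : k (t - x k1) = k w by rewrite /w /kfin kernel_per.
rewrite z2 -/u !addrA ltrD2r.
have bu : u - b < u by lra.
have wa : w < w + a by lra.
have := slope_lt (kernel_strictly_concave sK) Du' Du Dw Dw' bu uw wa.
have -> : w + a - w = a by ring.
rewrite subKr => sl.
have : rho k1 * a * ((k (w + a) - k w) / a) < rho k2 * b * ((k u - k (u - b)) / b).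
  by rewrite ab ltr_pM2l// mulr_gt0.
have -> : rho k1 * a * ((k (w + a) - k w) / a) = rho k1 * (k (w + a) - k w).
  by field; rewrite gt_eqF.
have -> : rho k2 * b * ((k u - k (u - b)) / b) = rho k2 * (k u - k (u - b)).
  by field; rewrite gt_eqF.
lra.
Qed.

(* Several nodes may coincide at either end of the arc; moving only the extreme ones,
   [k2] (last at [x 0]) and [k1.+1] (first at [x n]), preserves the order. *)
Lemma last_arc_max x : is_min K n rho x ->
  exists2 t, x n <= t <= x 0%N + 2 * pi & F x t = H x.
Proof.
move=> [cx xmin]; apply: contrapT => /forallPNP noarc.
have {}noarc t : x n <= t <= x 0%N + 2 * pi -> (F x t < H x)%E.
  by move=> tx; rewrite lt_neqAle tsum_le_tsup andbT; apply/negP => /eqP; exact: noarc.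
(* If all the nodes coincided, the last arc would be a full turn and contain a maximum. *)
have x0n : x 0%N < x n.
  rewrite ltNge; apply/negP => xn0.
  have [t /andP[t1 t2] Ft] := tsup_attained sK n rho0 x (x n).
  by have := noarc t; rewrite Ft ltxx => /(_ _)/wrap[]//; apply/andP; split; lra.
have [k2 [k2n x20 x2S]] : exists k2, [/\ (k2 < n)%N, x k2 = x 0%N & x k2 < x k2.+1].
  have ex : exists j, (j <= n)%N && (x j <= x 0%N) by exists 0%N; rewrite lexx.
  have ub j : (j <= n)%N && (x j <= x 0%N) -> (j <= n)%N by case/andP.
  case: (ex_maxnP ex ub) => j /andP[jn jx] jmax.
  have jn' : (j < n)%N.
    rewrite ltn_neqAle jn andbT; apply: contraTN x0n => /eqP <-.
    by rewrite -leNgt.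
  have xj0 : x j = x 0%N.
    by apply/eqP; rewrite eq_le jx (cyc_sorted_le cx)//.
  exists j; split=> //; rewrite xj0 ltNge; apply/negP => xS.
  by have := jmax j.+1; rewrite jn' xS ltnn => /(_ isT).
have [k1 [k1n x1n x1S]] : exists k1, [/\ (k1 < n)%N, x k1.+1 = x n & x k1 < x k1.+1].
  have ex : exists j, (j <= n)%N && (x n <= x j) by exists n; rewrite leqnn lexx.
  case: (ex_minnP ex) => -[|j] /andP[jn jx] jmin.
    by move: x0n; rewrite ltNge jx.
  have xjn : x j.+1 = x n.
    by apply/eqP; rewrite eq_le jx andbT (cyc_sorted_le cx)// jn leqnn.
  exists j; split=> //; rewrite xjn ltNge; apply/negP => xS.
  by have := jmin j; rewrite (ltnW jn) xS ltnn => /(_ isT).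
have k12 : k1.+1 != k2 by apply: contraTneq x0n => e; rewrite -x1n e x20 ltxx.
pose z e j : R := if j == k2 then x j + e / rho k2
  else if j == k1.+1 then x j - e / rho k1.+1 else x j.
have zcvg j : z e j @[e --> (0 : R)] --> x j.
  have dcvg c : e / c @[e --> (0 : R)] --> (0 : R).
    have h : e / c @[e --> (0 : R)] --> 0 / c.
      by apply: cvgM; [exact: cvg_id|exact: cvg_cst].
    by rewrite mul0r in h.
  rewrite /z; case: (j == k2).
    have h : x j + e / rho k2 @[e --> (0 : R)] --> x j + 0.
      by apply: cvgD; [exact: cvg_cst|exact: dcvg].
    by rewrite addr0 in h.
  case: (j == k1.+1); last exact: cvg_cst.
  have h : x j - e / rho k1.+1 @[e --> (0 : R)] --> x j - 0.
    by apply: cvgB; [exact: cvg_cst|exact: dcvg].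
  by rewrite subr0 in h.
(* By continuity the strict inequality holds with a margin [d] around the arc, which is to contain
   the widened arc. *)
have [d d0 Hd] : exists2 d, 0 < d &
    forall t, x n - d <= t <= x 0%N + 2 * pi + d -> (F x t < H x)%E.
  have nearlt t : (F x t < H x)%E -> \forall t' \near t, (F x t' < H x)%E.
    move=> Ft; apply: (@tsum_continuous R K sK n rho rho0 x t [set c | (c < H x)%E]).
    by apply: open_nbhs_nbhs; split => //; exact: open_ereal_lt_ereal.
  have /nbhs_ballP[d1 /= d10 Hd1] : \forall t' \near x n, (F x t' < H x)%E.
    by apply: nearlt; apply: noarc; rewrite lexx; exact: cx.2.
  have /nbhs_ballP[d2 /= d20 Hd2] : \forall t' \near x 0%N + 2 * pi, (F x t' < H x)%E.
    by apply: nearlt; apply: noarc; rewrite lexx andbT; exact: cx.2.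
  pose d := Num.min d1 d2 / 2.
  have m0 : 0 < Num.min d1 d2 by rewrite lt_min d10.
  have m1 : Num.min d1 d2 <= d1 by rewrite ge_min lexx.
  have m2 : Num.min d1 d2 <= d2 by rewrite ge_min lexx orbT.
  have [dd1 dd2] : d < d1 /\ d < d2 by rewrite /d; split; lra.
  exists d => [|t /andP[td dt]]; first by rewrite divr_gt0.
  have [tn|nt] := ltP t (x n).
    by apply: Hd1; rewrite /ball/= ger0_norm; lra.
  have [t0|t0] := leP t (x 0%N + 2 * pi); first by apply: noarc; rewrite nt.
  by apply: Hd2; rewrite /ball/= ltr0_norm; lra.
(* Compactness makes the inequality on the arc with its margin survive, uniformly in [t], small
   displacements of the nodes. *)
have nearz : \forall e \near (0 : R), `[x n - d, x 0%N + 2 * pi + d]%classic `<=`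
    [set t | (F (z e) t < H x)%E].
  have /compact_near_coveringP cc := @segment_compact R (x n - d) (x 0%N + 2 * pi + d).
  apply: (cc _ (nbhs (0 : R)) (fun e t => (F (z e) t < H x)%E)) => t /=.
  rewrite in_itv/= => /Hd Ft.
  have cv : F (z p.2) p.1 @[p --> (nbhs t, nbhs (0 : R))] --> F x t.
    apply: (@tsum_cvg R K sK n rho rho0 _ _ _ (fun p => z p.2) fst); last exact: cvg_fst.
    move=> j; apply: (@cvg_comp _ _ _ snd (fun e => z e j) _ (nbhs (0 : R))).
      exact: cvg_snd.
    exact: zcvg.
  apply: (cv [set c | (c < H x)%E]).
  by apply: open_nbhs_nbhs; split => //; exact: open_ereal_lt_ereal.
have small c e0 : 0 < c -> 0 < e0 -> \forall e \near (0 : R)^'+, e / c < e0.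
  move=> c0 e00; near=> e; rewrite ltr_pdivrMr//; near: e.
  by apply: nbhs_right_lt; exact: mulr_gt0.
(* Each node moves by less than half a gap because for [k1 = k2] both move into the same gap. *)
have g1 : 0 < (x k1.+1 - x k1) / 2 by lra.
have g2 : 0 < (x k2.+1 - x k2) / 2 by lra.
have [e [e0 nz [a1 a2] [b1 b2]]] : exists e, [/\ 0 < e,
   `[x n - d, x 0%N + 2 * pi + d]%classic `<=` [set t | (F (z e) t < H x)%E],
   e / rho k1.+1 < d /\ e / rho k1.+1 < (x k1.+1 - x k1) / 2 &
   e / rho k2 < d /\ e / rho k2 < (x k2.+1 - x k2) / 2].
  near (0 : R)^'+ => e; exists e; split.
  - by near: e; exact: nbhs_right_gt.
  - by near: e; exact: cvg_within nearz.
  - by split; near: e; exact: small.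
  - by split; near: e; exact: small.
set a := e / rho k1.+1 in a1 a2; set b := e / rho k2 in b1 b2.
have a0 : 0 < a by rewrite divr_gt0.
have b0 : 0 < b by rewrite divr_gt0.
have cz : cyc_sorted n (z e).
  split=> [j jn|].
    have := cx.1 j jn; rewrite /z -/a -/b !eqSS.
    have [->|_] := eqVneq j k2.
      rewrite eqn_leq ltnn/=.
      by case: eqVneq => [k21|_] _; [rewrite k21 in b2 *|]; lra.
    have [->|_] := eqVneq j k1.+1.
      by rewrite [k1.+1 == k1]gtn_eqF//; case: (k1.+2 == k2) => ?; lra.
    case: (j.+1 == k2) => [?|]; first by lra.
    by case: eqVneq => [->|_] ?; lra.
  have zn : z e n <= x n by rewrite /z -/a -/b gtn_eqF//; case: ifP => _; lra.
  have z0 : x 0%N <= z e 0%N by rewrite /z -/a -/b /=; case: ifP => _; lra.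
  have := cx.2; lra.
have Hxz := xmin _ cz.
have [t /andP[t1 t2] Ft] := tsup_attained sK n rho0 (z e) (x n - a).
have [tb|tb] := leP t (x 0%N + 2 * pi + b).
  have : (F (z e) t < H x)%E by apply: nz; rewrite /= in_itv/=; apply/andP; split; lra.
  by rewrite Ft ltNge Hxz.
(* The maximum is outside the widened arc; one period back it falls between [x 0%N + b] and
   [x n - a], where [pull_apart_lt] applies. *)
have Ft' : F (z e) (t - 2 * pi) = H (z e).
  rewrite -Ft; have := @tsum_per_int R K sK n rho (z e) (t - 2 * pi) 1.
  by rewrite mulr1z mulr1 subrK.
have : (F (z e) (t - 2 * pi)%R < F x (t - 2 * pi)%R)%E.
  apply: (@pull_apart_lt x k1.+1 k2 a b) => //; rewrite ?x1n ?x20//.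
  - exact: ltnW.
  - exact: cx.2.
  - have re c : 0 < c -> c * (e / c) = e by move=> ?; rewrite mulrC mulfVK ?gt_eqF.
    by rewrite /a /b !re.
  - lra.
  - lra.
  - by rewrite Ft' (lt_le_trans _ Hxz)// tsup_gtNy.
rewrite Ft' => /lt_le_trans/(_ (tsum_le_tsup _ _ _ _ _)).
by rewrite ltNge Hxz.
Unshelve. all: by end_near. Qed.

Lemma tsum_translate x c t : F (fun j => x j + c) t = F x (t - c).
Proof. by apply: eq_bigr => j _; rewrite opprD addrA addrAC. Qed.

Lemma tsup_translate x c : H (fun j => x j + c) = H x.
Proof.
congr ereal_sup; apply/seteqP; split=> _ [t _ <-].
  by exists (t - c); rewrite ?tsum_translate.
by exists (t + c); rewrite ?tsum_translate ?addrK.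
Qed.

Lemma cyc_sorted_translate x c : cyc_sorted n x -> cyc_sorted n (fun j => x j + c).
Proof.
move=> [s1 s2]; split=> [j jn|]; first by rewrite lerD2r s1.
by rewrite addrAC lerD2r.
Qed.

Lemma is_min_translate x c : is_min K n rho x -> is_min K n rho (fun j => x j + c).
Proof.
move=> [cx xmin]; split; first exact: cyc_sorted_translate.
by move=> z cz; rewrite tsup_translate xmin.
Qed.

(** By translation the first node may be put at 0, which confines the others to [[0, 2 * pi]]. The
    ordered configurations, encoded as row vectors, then have a compact domain, and a supremum of
    continuous functions is lower semicontinuous. *)
Lemma is_min_exists : exists x, is_min K n rho x.
Proof.
pose sq (v : 'rV[R]_n.+1) j := v ord0 (inord j).
pose B := [set v : 'rV[R]_n.+1 | forall i, `[0, 2 * pi]%classic (v ord0 i)].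
pose C := [set v : 'rV[R]_n.+1 | cyc_sorted n (sq v)].
have sqc j : continuous (sq ^~ j) by exact: (@coord_continuous R 1 n.+1 ord0 (inord j)).
have cB : compact B.
  apply: (@rV_compact R n.+1 (fun=> `[0, 2 * pi]%classic)) => i.
  exact: segment_compact.
have clC : closed C.
  have -> : C = \bigcap_(j in [set j | (j <= n)%N])
      [set v | 0 <= next_node n (sq v) j - sq v j].
    apply/seteqP; split=> v /=.
      by move=> /cyc_sortedP h j /= jn; rewrite subr_ge0 h.
    by move=> h; apply/cyc_sortedP => j jn; rewrite -subr_ge0; exact: h.
  apply: closed_bigI => j _.
  have cnext : continuous (fun v => next_node n (sq v) j).
    rewrite /next_node; case: (j < n)%N; first exact: sqc.
    by move=> v; exact: (cvgD (sqc 0%N v) (cvg_cst _)).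
  have cg : continuous (fun v => next_node n (sq v) j - sq v j).
    by move=> v; exact: (cvgB (cnext v) (sqc j v)).
  apply: (@closed_comp _ _ (fun v => next_node n (sq v) j - sq v j) [set c | 0 <= c]).
    by move=> v _; exact: cg.
  exact: closed_ge.
have cA : compact (B `&` C) by exact: compact_closedI.
have inA z : cyc_sorted n z -> z 0%N = 0 ->
    exists2 v, (B `&` C) v & H (sq v) = H z.
  move=> cz z0.
  have sqz j : (j <= n)%N -> sq (\row_i z i) j = z j.
    by move=> jn; rewrite /sq mxE inordK.
  exists (\row_i z i); last first.
    rewrite /tsup (_ : F _ = F z)//; apply/funext => t; apply: eq_bigr => j _.
    by rewrite sqz// -ltnS.
  split=> [i|]; last first.
    split=> [j jn|]; first by rewrite !sqz// ?(ltnW jn)//; exact: cz.1.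
    by rewrite !sqz//; exact: cz.2.
  have iN : (i <= n)%N by rewrite -ltnS.
  have zin : z i <= z n by apply: (cyc_sorted_le cz); rewrite iN leqnn.
  have zi0 : z 0%N <= z i by apply: (cyc_sorted_le cz).
  have := cz.2; rewrite /= in_itv/= mxE; rewrite z0 in zi0 * => ?.
  by apply/andP; split; lra.
have [||v [_ Cv] vmin] := compact_lsc_min (f := fun v => H (sq v)) cA.
- have [|v Av _] := @inA (fun=> 0) _ erefl; last by exists v.
  by split=> //=; rewrite add0r ltW.
- move=> v c _ /ereal_sup_gt[_ [t _ <-] cF].
  have cv : F (sq w) t @[w --> v] --> F (sq v) t.
    apply: (@tsum_cvg R K sK n rho rho0 _ (nbhs v) (nbhs_filter v) sq (fun=> t)).
      by move=> j; exact: sqc.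
    exact: cvg_cst.
  have : \forall w \near v, (c < F (sq w) t)%E.
    apply: (cv [set d | (c < d)%E]).
    by apply: open_nbhs_nbhs; split => //; exact: open_ereal_gt_ereal.
  by apply: filterS => w cw; apply: lt_le_trans cw _; exact: tsum_le_tsup.
exists (sq v); split=> // z cz.
have [||w Aw] := @inA (fun j => z j + - z 0%N); rewrite ?subrr//.
  exact: cyc_sorted_translate.
by rewrite tsup_translate => <-; exact: vmin.
Qed.

End FixedWeights.

(* Relabelling the nodes cyclically turns the arc [j] into the arc [j.+1], which
   reduces every arc to the last one. *)
Definition unshift x j : R := if j is i.+1 then x i else x n - 2 * pi.
Definition unshift_weight rho j : R := if j is i.+1 then rho i else rho n.

Lemma next_unshift x j : (j <= n)%N -> next_node n (unshift x) j = x j.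
Proof.
move=> jn; rewrite /next_node /unshift; case: ltnP => //= nj.
by rewrite subrK; congr x; apply/eqP; rewrite eqn_leq nj.
Qed.

Lemma tsum_next rho z t :
  tsum K n (unshift_weight rho) z t = tsum K n rho (next_node n z) t.
Proof.
rewrite /tsum big_ord_recl big_ord_recr /= addeC; congr (_ + _)%E.
  by apply: eq_bigr => i _; rewrite /next_node ltn_ord.
by rewrite /next_node ltnn opprD addrA kernel_perN.
Qed.

Lemma tsup_next rho z :
  tsup K n (unshift_weight rho) z = tsup K n rho (next_node n z).
Proof. by rewrite /tsup (funext (tsum_next rho z)). Qed.

Lemma tsum_unshift rho x t :
  tsum K n (unshift_weight rho) (unshift x) t = tsum K n rho x t.
Proof.
rewrite tsum_next; apply: eq_bigr => j _; rewrite next_unshift//.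
by rewrite -ltnS.
Qed.

Lemma tsup_unshift rho x :
  tsup K n (unshift_weight rho) (unshift x) = tsup K n rho x.
Proof. by rewrite /tsup (funext (tsum_unshift rho x)). Qed.

Lemma cyc_sorted_next_node (z : nat -> R) :
  cyc_sorted n z -> cyc_sorted n (next_node n z).
Proof.
move=> cz; split=> [j jn|].
  by rewrite {1}/next_node jn cyc_sorted_next.
by rewrite {1}/next_node ltnn lerD2r cyc_sorted_next.
Qed.

Lemma cyc_sorted_unshift x : cyc_sorted n x -> cyc_sorted n (unshift x).
Proof.
move=> cx; apply/cyc_sortedP => j jn; rewrite next_unshift//.
case: j jn => [_|j jn] /=; last exact: cx.1.
by have := cx.2; lra.
Qed.

Lemma is_min_unshift rho x : is_min K n rho x ->
  is_min K n (unshift_weight rho) (unshift x).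
Proof.
move=> [cx xmin]; split; first exact: cyc_sorted_unshift.
by move=> z cz; rewrite tsup_unshift tsup_next xmin//; exact: cyc_sorted_next_node.
Qed.

Lemma arc_max rho x j : (forall i, 0 < rho i) -> is_min K n rho x -> (j <= n)%N ->
  exists2 t, x j <= t <= next_node n x j & tsum K n rho x t = tsup K n rho x.
Proof.
(* Weights and nodes are both generalized in the induction on [n - j], since each relabelling
   changes both. *)
move=> + + jn; have [m] := ubnP (n - j); elim: m => // m IH in rho x j jn *.
move=> + rho0 xmin; rewrite ltnS => njm.
have [nj|jn'] := leqP n j.
  have -> : j = n by apply/eqP; rewrite eqn_leq jn.
  by rewrite /next_node ltnn; exact: last_arc_max.
have njm' : (n - j.+1 < m)%N by apply: leq_trans njm; rewrite ltn_sub2l.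
have rho0' i : 0 < unshift_weight rho i by case: i => [|i] /=.
have [t] := IH (unshift_weight rho) (unshift x) j.+1 jn' njm' rho0' (is_min_unshift xmin).
by rewrite next_unshift//= /next_node jn' tsum_unshift tsup_unshift => ? ?; exists t.
Qed.

(** * The sandwich property and uniqueness *)

Section Sandwich.
Variable rho : nat -> R.
Hypothesis rho0 : forall j, 0 < rho j.
Local Notation F := (tsum K n rho).
Local Notation H := (tsup K n rho).

(** A degenerate arc would reduce to a node carrying the maximum, which [tsum_node_lt] forbids. *)
Lemma is_min_strict x j : cond_inf' K \/ C1_0_2pi K -> is_min K n rho x ->
  (j <= n)%N -> x j < next_node n x j.
Proof.
move=> hK xmin jn; have [t /andP[t1 t2] Ft] := arc_max rho0 xmin jn.
apply: lt_le_trans t2; rewrite lt_neqAle t1 andbT; apply: contra_eqN Ft => /eqP <-.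
by rewrite lt_eqF// tsum_node_lt//; case: xmin.
Qed.

(* [x] lies on the segment from [y] to [z := x - e (y - x)]; concavity along it
   forces [F z < H x] everywhere. *)
Lemma sandwich x y : is_min K n rho x ->
  (forall j, (j <= n)%N -> x j < next_node n x j) -> cyc_sorted n y ->
  ~ (forall j, (j <= n)%N -> exists2 t, y j <= t <= next_node n y j & (H x < F y t)%E).
Proof.
move=> [cx xmin] xlt cy ytop.
(* Arcs of [y] have length at most [2 * pi], so such an [e] keeps the nodes [z] in order. *)
have [e e0 egap] : exists2 e : R, 0 < e &
    forall j : 'I_n.+1, e * (2 * pi) < next_node n x j - x j.
  have gap : \forall e \near (0 : R)^'+,
      forall j : 'I_n.+1, e * (2 * pi) < next_node n x j - x j.
    apply: filter_forall => j; near=> e; rewrite -ltr_pdivlMr//; near: e.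
    by apply: nbhs_right_lt; rewrite divr_gt0// subr_gt0 xlt// -ltnS.
  near (0 : R)^'+ => e; exists e; first by near: e; exact: nbhs_right_gt.
  by near: e.
pose z i := (1 + e) * x i - e * y i.
have znext j : next_node n z j =
    (1 + e) * next_node n x j - e * next_node n y j.
  by rewrite /next_node /z; case: ifP => _; ring.
have cz : cyc_sorted n z.
  apply/cyc_sortedP => j jn; rewrite znext /z.
  have jn' : (j < n.+1)%N by [].
  have /= := egap (Ordinal jn').
  have : next_node n y j <= y j + 2 * pi.
    by apply: (cyc_sorted_next_2pi cy); rewrite leqnn.
  rewrite -(ler_pM2l e0) => h1 h2.
  have := mulr_gt0 e0 (_ : 0 < next_node n x j - x j).
  rewrite subr_gt0 xlt// => /(_ isT) h3; lra.
have [t tz Ft] := tsup_attained sK n rho0 z (z 0%N).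
have [j jn tj] := arc_cover cz tz.
have [u uj Fu] := ytop j jn.
have fH := tsup_fin sK rho0 cx.
(* This is the weight for which [l * z + (1 - l) * y = x]. *)
pose l := (1 + e)^-1.
have e1 : 0 < 1 + e by lra.
have l0 : 0 < l by rewrite invr_gt0.
have l1 : l < 1 by rewrite invf_lt1//; lra.
have := @tsum_conv rho rho0 z y j t u l (fine (H x)) cz cy jn tj uj.
rewrite l0 l1 fineK// Ft xmin// ltW// => /(_ isT isT isT (or_introl Fu)).
have -> : (fun i => l * z i + (1 - l) * y i) = x.
  by apply/funext => i; rewrite /z /l; field; rewrite gt_eqF.
by rewrite ltNge tsum_le_tsup.
Unshelve. all: by end_near. Qed.

(** Let [z] be the midpoint of two distinct minimizers. On each arc, the midpoint of their maximum
    points gives a value above [H x], contradicting [sandwich]. Concavity is strict there: if all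
    the differences agreed, the common first node would force the minimizers to coincide. *)
Lemma is_min_unique x y : cond_inf' K \/ C1_0_2pi K -> is_min K n rho x ->
  is_min K n rho y -> x 0%N = y 0%N -> forall i, (i <= n)%N -> x i = y i.
Proof.
move=> hK xmin ymin xy0 i iN; apply: contrapT => /eqP xyi.
have Hxy : H x = H y.
  by apply/eqP; rewrite eq_le xmin.2 ?ymin.2//; [case: xmin|case: ymin].
have fH := tsup_fin sK rho0 xmin.1.
have l01 : 0 < (2^-1 : R) < 1 by apply/andP; split; lra.
pose z i := 2^-1 * x i + (1 - 2^-1) * y i.
have znext j : next_node n z j = 2^-1 * next_node n x j + (1 - 2^-1) * next_node n y j.
  by rewrite /next_node /z; case: ifP => _; lra.
apply: (@sandwich x z) => //; first by move=> j jn; exact: is_min_strict.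
  apply/cyc_sortedP => j jn; rewrite znext /z.
  have := cyc_sorted_next xmin.1 jn; have := cyc_sorted_next ymin.1 jn; lra.
move=> j jn.
have [t tj Ft] := arc_max rho0 xmin jn; have [u uj Fu] := arc_max rho0 ymin jn.
exists (2^-1 * t + (1 - 2^-1) * u).
  by rewrite znext /z; case/andP: tj => ? ?; case/andP: uj => ? ?; apply/andP; split; lra.
rewrite -(fineK fH); apply: (tsum_conv rho0 xmin.1 ymin.1 jn) => //.
- by rewrite fineK// Ft.
- by rewrite fineK// Fu Hxy.
right; apply: contrapT => /forallPNP h.
have {}h i' : (i' <= n)%N -> t - x i' = u - y i'.
  by move=> i'n; apply/eqP; apply: contrapT => /negP; exact: h.
have := h 0%N (leq0n n); have := h i iN; rewrite xy0 => h1 h2.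
by move/eqP: xyi; apply; lra.
Qed.

End Sandwich.
End Minimizer.

(** * Translation between the simplex of [s] and cyclically ordered nodes *)

Definition sorted_weight (R : realType) n (r0 : R) (r : 'I_n -> R) (s : 'S_n) k : R :=
  if k is k'.+1 then
    if (insub k' : option 'I_n) is Some i then r (s i) else 1
  else r0.

Section Simplex.
Variables (R : realType) (K : R -> \bar R).
Hypothesis sK : strictly_concave_kernel K.
Variables (n : nat) (r0 : R) (r : 'I_n -> R) (s : 'S_n).
Hypotheses (r0_gt0 : 0 < r0) (r_gt0 : forall j, 0 < r j).
Implicit Types (y : 'I_n -> R).
Local Notation rho := (sorted_weight r0 r s).
Local Notation F := (tsum K n rho).
Local Notation H := (tsup K n rho).

(** The default weight 1 past index [n] makes positivity hold at every index, as the cyclic lemmas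
    ask. *)
Lemma sorted_weight_gt0 j : 0 < rho j.
Proof. by case: j => //= j; case: insub. Qed.

Lemma node_ord y (i : 'I_n) : node s y i.+1 = y (s i).
Proof. by rewrite /= valK. Qed.

Lemma node_last y : node s y n.+1 = 2 * pi.
Proof. by rewrite /= insubN// ltnn. Qed.

Lemma next_nodeE y k : (k <= n)%N -> next_node n (node s y) k = node s y k.+1.
Proof.
move=> kn; rewrite /next_node; case: ltnP => // nk.
have -> : k = n by apply/eqP; rewrite eqn_leq kn.
by rewrite node_last add0r.
Qed.

Lemma FsumE y t : Fsum K r0 r y t = F (node s y) t.
Proof.
rewrite /Fsum /tsum big_ord_recl /= subr0; congr (_ + _)%E.
rewrite (reindex_inj (@perm_inj _ s))/=; apply: eq_bigr => i _.
by rewrite /bump/= valK.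
Qed.

Lemma Ssig_clE y : Ssig_cl s y <-> cyc_sorted n (node s y).
Proof.
rewrite cyc_sortedP; split=> h k kn; last by have := h k kn; rewrite next_nodeE.
by rewrite next_nodeE//; exact: h.
Qed.

Lemma Ssig_cl_sub y : Ssig s y -> Ssig_cl s y.
Proof. by move=> h k kn; exact/ltW/h. Qed.

Lemma supFE y : supF K r0 r y = H (node s y).
Proof.
apply/eqP; rewrite eq_le; apply/andP; split; apply: ge_ereal_sup => _ [t _ <-].
  by rewrite FsumE; exact: tsum_le_tsup.
have [u u0 <-] := tsum_repr sK n rho (node s y) 0 t.
by apply: ereal_sup_ubound; exists u; rewrite ?FsumE//= -[X in _ < X]add0r.
Qed.

Lemma mint_le_tsup y k : (mint K r0 r s y k <= H (node s y))%E.
Proof. by apply: ge_ereal_sup => _ [t _ <-]; rewrite FsumE; exact: tsum_le_tsup. Qed.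

Lemma mbarE y : Ssig_cl s y -> mbar K r0 r s y = H (node s y).
Proof.
move=> /Ssig_clE cy; apply/eqP; rewrite eq_le; apply/andP; split.
  by apply/bigmax_leP; split=> [|k _]; [exact: leNye|exact: mint_le_tsup].
have [t t0 <-] := tsup_attained sK n sorted_weight_gt0 (node s y) 0.
have [j jn tj] := @arc_cover R n (node s y) t cy t0.
have jn' : (j < n.+1)%N by [].
apply: le_trans (le_bigmax _ _ (Ordinal jn')).
apply: ereal_sup_ubound; exists t; last exact: FsumE.
by move: tj; rewrite next_nodeE.
Qed.

Lemma node_of_sequence (x : nat -> R) : x 0%N = 0 ->
  exists y, forall k, (k <= n)%N -> node s y k = x k.
Proof.
move=> x0; exists (fun j => x (s^-1%g j).+1) => -[_|k kn]; first by rewrite x0.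
by rewrite (node_ord _ (Ordinal kn)) permK.
Qed.

Lemma is_min_ext (x x' : nat -> R) : (forall k, (k <= n)%N -> x' k = x k) ->
  is_min K n rho x -> is_min K n rho x'.
Proof.
move=> xx' [[s1 s2] xmin].
have FE : F x' = F x.
  by apply/funext => t; apply: eq_bigr => j _; rewrite xx'// -ltnS.
rewrite /is_min /tsup FE; split=> //; split=> [j jn|].
  by rewrite !xx'// ?s1// ltnW.
by rewrite !xx'.
Qed.

End Simplex.

Theorem theorem13p1 (R : realType) (K : R -> \bar R) (n : nat)
  (r0 : R) (r : 'I_n -> R) (s : 'S_n) :
  strictly_concave_kernel K ->
  (cond_inf' K \/ C1_0_2pi K) ->
  0 < r0 -> (forall j, 0 < r j) ->
  exists w : 'I_n -> R,
    [/\ (Ssig s w /\ MS K r0 r s = supF K r0 r w),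
        (forall w' : 'I_n -> R, Ssig s w' -> MS K r0 r s = supF K r0 r w' -> w' = w),
        (* (a) *)
        ((forall i, w i != 0) /\ (forall i j, i != j -> w i != w j)) /\
          (forall k l : 'I_n.+1, mint K r0 r s w k = mint K r0 r s w l),
        (* (b) *)
        [/\ ereal_inf [set mbar K r0 r s y | y in Ssig s] = MS K r0 r s,
            MS K r0 r s = mS K r0 r s &
            mS K r0 r s = ereal_sup [set mlow K r0 r s y | y in Ssig s]] &
        (* (c) *)
        (forall x y, Ssig_cl s x -> Ssig_cl s y ->
           (mlow K r0 r s x <= MS K r0 r s)%E /\ (MS K r0 r s <= mbar K r0 r s y)%E)].
Proof.
move=> sK hK r0_gt0 r_gt0.
pose rho := sorted_weight r0 r s.
have rho0 : forall j, 0 < rho j by move=> j; exact: sorted_weight_gt0.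
have [x xmin] := @is_min_exists R K sK n rho rho0.
(* The minimizer is rotated so that its first node is 0. *)
have [w wx] := @node_of_sequence R n s (fun j => x j + - x 0%N) (subrr _).
have wmin : is_min K n rho (node s w) by apply: is_min_ext wx (is_min_translate _ xmin).
have wlt k : (k <= n)%N -> node s w k < next_node n (node s w) k.
  exact: (is_min_strict sK rho0 hK wmin).
have wS : Ssig s w by move=> k kn; rewrite -next_nodeE// wlt.
(* The minimum over the closed simplex is attained at [w], which lies in the open one, so it is also
   the infimum over the open one. *)
have MSE : MS K r0 r s = tsup K n rho (node s w).
  apply/eqP; rewrite eq_le; apply/andP; split.
    by apply: ereal_inf_lbound; exists w => //; exact: supFE.
  apply: le_ereal_inf_tmp => _ [y yS <-]; rewrite (supFE sK r0 r s).
  by apply: wmin.2; apply/Ssig_clE; exact: Ssig_cl_sub.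
have mintw k : mint K r0 r s w k = tsup K n rho (node s w).
  apply/eqP; rewrite eq_le mint_le_tsup/=.
  have kn : (k <= n)%N by rewrite -ltnS.
  have [t tk <-] := arc_max sK rho0 wmin kn.
  by apply: ereal_sup_ubound; exists t; [move: tk; rewrite next_nodeE|exact: FsumE].
have low y : Ssig_cl s y -> (mlow K r0 r s y <= MS K r0 r s)%E.
  move=> /Ssig_clE cy; rewrite leNgt; apply/negP => /bigmin_gtP[_ mu_lt].
  (* A smallest arc supremum above [M(S)] would provide on every arc a point with value above it. *)
  apply: (sandwich sK rho0 wmin wlt cy) => j jn.
  have jn' : (j < n.+1)%N by [].
  have := mu_lt (Ordinal jn') isT; rewrite MSE => /ereal_sup_gt[_ [t tj <-]].
  by rewrite (FsumE K r0 r s) => Ft; exists t => //; rewrite next_nodeE.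
have lown : mlow K r0 r s w = tsup K n rho (node s w).
  apply/eqP; rewrite eq_le -{1}MSE low ?andTb; last exact: Ssig_cl_sub.
  by apply/bigmin_geP; split=> [|k _]; [exact: leey|rewrite mintw].
exists w; split.
- by split=> //; rewrite MSE (supFE sK r0 r s).
- move=> w' w'S; rewrite MSE (supFE sK r0 r s) => Hw'.
  have w'min : is_min K n rho (node s w').
    split; first by apply/Ssig_clE; exact: Ssig_cl_sub.
    by move=> z cz; rewrite -Hw'; exact: wmin.2.
  apply/funext => i.
  have := is_min_unique sK rho0 hK w'min wmin erefl (ltn_ord ((s^-1%g : 'S_n) i)).
  by rewrite !node_ord permKV.
- split; last by move=> k l; rewrite !mintw.
  have lt_nodes i j : (i < j <= n)%N -> node s w i < node s w j.
    move=> /andP[ij jn]; have cw : cyc_sorted n (node s w) by case: wmin.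
    apply: lt_le_trans (wlt i (leq_trans (ltnW ij) jn)) _.
    by apply: (cyc_sorted_next_le cw); rewrite ij.
  split=> [i|i j].
    have := @lt_nodes 0%N ((s^-1%g : 'S_n) i).+1; rewrite ltn_ord node_ord permKV.
    by move=> /(_ isT)/gt_eqF ->.
  (* Indices are replaced by their positions in the order of [s], where the nodes increase
     strictly. *)
  rewrite -[i](permKV s) -[j](permKV s).
  move: ((s^-1%g : 'S_n) i) ((s^-1%g : 'S_n) j) => {}i {}j ij.
  have {}ij : i != j by apply: contraNneq ij => ->.
  rewrite -!node_ord; have [lt|gt|/val_inj e] := ltngtP i j.
  + by rewrite lt_eqF// lt_nodes// ltnS lt ltn_ord.
  + by rewrite gt_eqF// lt_nodes// ltnS gt ltn_ord.
  + by rewrite e eqxx in ij.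
- split=> //.
    congr ereal_inf; apply: eq_imagel => y yS.
    by rewrite (supFE sK r0 r s) mbarE//; exact: Ssig_cl_sub.
  apply/eqP; rewrite eq_le; apply/andP; split.
    by rewrite MSE -lown; apply: ereal_sup_ubound; exists w.
  by apply: ge_ereal_sup => _ [y yS <-]; apply: low; exact: Ssig_cl_sub.
- move=> y z yS zS; split; first exact: low.
  by rewrite MSE mbarE//; apply: wmin.2; exact/Ssig_clE.
Qed.
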